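(* Let $\varphi\in\Phi$ be an irreducible (with irreducible powers) automorphism of $F_N$, where $\Phi$ is its outer class. Let $\tau=(\Gamma,*,\pi,f)$ be an irreducible train-track representative for $\Phi$, $\tilde f$ the lift of $f$ to the universal cover $\tilde\Gamma$ associated to $\varphi$, and $H$ the homothety of $\overline T_{\Phi^{-1}}$ associated to $\varphi$. For each edge $\tilde e$ of $\tilde\Gamma$, \[ \Omega_{\tilde e}=\bigcup_{(\tilde e',\tilde p,\tilde s)}H(\Omega_{\tilde e'}), \] where the finite union is taken over all triples $(\tilde e',\tilde p,\tilde s)$ such that $\tilde e'$ is an edge of $\tilde\Gamma$, $\tilde p.\tilde e.\tilde s$ is a reduced path in $\tilde\Gamma$ and $\tilde f(\tilde e')=\tilde p.\tilde e.\tilde s$. This decomposition of $\Omega_{\tilde e}$ does not depend on the choice of a particular automorphism $\varphi$ in the outer class $\Phi$, of the associated lift $\tilde f$ of $f$ and of the associated homothety $H$.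
   Context: $F_N$ is the free group of finite rank $N\ge 2$, $\partial F_N$ its Gromov boundary, $\partial^2F_N=(\partial F_N)^2\smallsetminus\Delta$ ($\Delta$ the diagonal); elements of $\partial^2F_N$ are lines. Train-tracks. A chart $(\Gamma,*,\pi)$ is a finite graph $\Gamma$ with base point $*$ and an isomorphism $\pi:F_N\to\pi_1(\Gamma,* )$; $F_N$ acts on the universal cover $\tilde\Gamma$ (a tree) by deck transformations and $\partial\pi:\partial F_N\to\partial\tilde\Gamma$ is the induced homeomorphism. Edges and paths are oriented. The geometric realisation of a line $(X,Y)$ is the bi-infinite oriented geodesic $[\partial\pi(X),\partial\pi(Y)]$; for a finite oriented geodesic path $\gamma$ in $\tilde\Gamma$, $C_\Gamma(\gamma)$ is the set of lines whose geometric realisation contains $\gamma$. A topological representative of $\Phi\in\mathrm{Out}(F_N)$ is a continuous $f:\Gamma\to\Gamma$ sending vertices to vertices and edges to finite reduced paths, which is a homotopy equivalence inducing $\Phi$ through $\pi$. The lift $\tilde f:\tilde\Gamma\to\tilde\Gamma$ associated to $\varphi\in\Phi$ is the one with $\tilde f(uP)=\varphi(u)\tilde f(P)$ for all $u\in F_N$, $P\in\tilde\Gamma$. $\tau=(\Gamma,*,\pi,f)$ is a train-track representative if moreover $f^n$ is locally injective on each edge for all $n\ge1$; it is irreducible if $\Gamma$ has no vertex of valence $1$ or $2$ and no non-trivial $f$-invariant subgraph. $\Phi$ (or $\varphi\in\Phi$) is irreducible (with irreducible powers) if for each $n\geq 1$, $\Phi^n$ fixes no conjugacy class of a (proper, non-trivial)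 free factor. The expansion factor $\lambda_\Phi>1$ is the Perron-Frobenius eigenvalue of the matrix $(m_{e,e'})$, $m_{e,e'}$ being the number of occurrences of $e$ (in either orientation) in $f(e')$, for any irreducible train-track representative of $\Phi$. Attracting lamination: $L_\Phi$ is the set of lines $(X,Y)$ for which there are $\epsilon=\pm1$ and $u_n\in F_N$ such that the paths $u_n\tilde f^n(e^\epsilon)$ converge to $(X,Y)$ (initial points to $\partial\pi(X)$, terminal points to $\partial\pi(Y)$ in $\tilde\Gamma\cup\partial\tilde\Gamma$), where $e$ is any fixed edge of $\tilde\Gamma$ for an irreducible train-track representative; it depends only on $\Phi$. For an oriented edge $\tilde e$ of $\tilde\Gamma$, $C_{\tilde e}=C_\Gamma(\tilde e)\cap L_\Phi$. Repelling tree: $\Phi$ acts on the projectivized compactified Outer Space (projective classes of $\mathbb R$-trees with minimal, very small isometric action of $F_N$) with exactly two fixed points, the attracting one $[T_\Phi]$ and the repelling one $[T_{\Phi^{-1}}]$; a representative $T_{\Phi^{-1}}$ of the latter is fixed, and the action on it has dense orbits. For each $\varphi\in\Phi$ the associated homothety $H$ of the metric completion $\overline T_{\Phi^{-1}}$, of ratio $1/\lambda_{\Phi^{-1}}<1$, satisfies $H(uP)=\varphi(u)H(P)$ for all $u\in F_N$ and all $P$. Let $\hat T=\overline T_{\Phi^{-1}}\cup\partial T_{\Phi^{-1}}$ with the observers' topology, generated by the connected components of $\hat T\smallsetminus\{P\}$, $P\in\hat T$. There is a unique equivariant continuous map $\mathcal Q:\partial F_N\to\hat T$ (observers' topology) extending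 continuously $u\mapsto uP$ for any $P\in\overline T_{\Phi^{-1}}$. The dual lamination is $L(T_{\Phi^{-1}})=\{(X,Y)\in\partial^2F_N\mid\mathcal Q(X)=\mathcal Q(Y)\}$, which contains $L_\Phi$; $\mathcal Q^2:L(T_{\Phi^{-1}})\to\hat T$ is $(X,Y)\mapsto\mathcal Q(X)=\mathcal Q(Y)$, continuous for the metric topology, with image in $\overline T_{\Phi^{-1}}$. For an edge $\tilde e$ of $\tilde\Gamma$, $\Omega_{\tilde e}=\mathcal Q^2(C_{\tilde e})$. *)

(* Defs.v *)
From HB Require Import structures.
From mathcomp Require Import all_boot all_order all_algebra.
From mathcomp Require Import all_classical all_reals.
From mathcomp Require Import all_analysis.

Set Implicit Arguments.
Unset Strict Implicit.
Unset Printing Implicit Defensive.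

Import Order.TTheory GRing.Theory Num.Theory.
Import numFieldNormedType.Exports.

Local Open Scope classical_set_scope.
Local Open Scope ring_scope.

(* Words over an alphabet A with a formal inverse [inv]: letters x_i^{+-1} for
   F_N, oriented edges with reversal for paths in a graph. *)
Section Words.
Variables (A : eqType) (inv : A -> A).

Definition reduced (s : seq A) : bool := sorted (fun a b => b != inv a) s.

Definition push (a : A) (s : seq A) : seq A :=
  if s is b :: s' then if b == inv a then s' else a :: s else [:: a].

Definition wmul (s t : seq A) : seq A := foldr push t s.
Definition wred (s : seq A) : seq A := wmul s [::].
Definition winv (s : seq A) : seq A := rev (map inv s).

Definition reduced_inf (X : nat -> A) : Prop := forall n, X n.+1 <> inv (X n).

Definition cvg_word (w : nat -> seq A) (X : nat -> A) : Prop :=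
  forall k, \forall n \near \oo, take k (w n) = mkseq X k.

Hypothesis invK : involutive inv.

Lemma reduced_push a s : reduced s -> reduced (push a s).
Proof.
case: s => [//|b s] /=; case: eqVneq => [_|nba rs] /=; first exact: path_sorted.
by rewrite nba.
Qed.

Lemma reduced_wmul s t : reduced t -> reduced (wmul s t).
Proof. by move=> rt; elim: s => //= a s; apply: reduced_push. Qed.

Lemma push_id a s : reduced (a :: s) -> push a s = a :: s.
Proof. by case: s => //= b s /andP[/negPf->]. Qed.

Lemma pushVK a s : reduced s -> push (inv a) (push a s) = s.
Proof.
case: s => [_|b s rs] /=; first by rewrite invK eqxx.
case: eqVneq rs => [->|_] rs /=; last by rewrite invK eqxx.
exact: push_id.
Qed.

Lemma pushKV a s : reduced s -> push a (push (inv a) s) = s.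
Proof. by move=> rs; rewrite -{1}[a]invK pushVK. Qed.

Lemma wmul_push a s t : reduced t -> wmul (push a s) t = push a (wmul s t).
Proof.
case: s => [//|b s] rt /=; case: eqVneq => [->|//].
by rewrite pushKV // reduced_wmul.
Qed.

Lemma wmulA s t w : reduced w -> wmul (wmul s t) w = wmul s (wmul t w).
Proof. by move=> rw; elim: s => //= a s IH; rewrite wmul_push // IH. Qed.

Lemma wmul_cat s t w : wmul (s ++ t) w = wmul s (wmul t w).
Proof. by rewrite /wmul foldr_cat. Qed.

Lemma wmuls0 s : reduced s -> wmul s [::] = s.
Proof.
elim: s => //= a s IH rs; rewrite IH ?push_id //; exact: path_sorted rs.
Qed.

Lemma winv_cons a s : winv (a :: s) = rcons (winv s) (inv a).
Proof. by rewrite /winv /= rev_cons. Qed.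

Lemma winvK : involutive winv.
Proof. by move=> s; rewrite /winv map_rev revK -map_comp map_id_in //= => x _; rewrite /= invK. Qed.

Lemma reduced_winv s : reduced s -> reduced (winv s).
Proof.
rewrite /reduced /winv rev_sorted sorted_map.
apply: sub_sorted => a b /=; apply: contraNneq => ->.
by rewrite !invK.
Qed.

Lemma wmulVs s t : reduced t -> wmul (winv s) (wmul s t) = t.
Proof.
move=> rt; elim: s => // a s IH.
by rewrite winv_cons -cats1 wmul_cat /= pushVK ?reduced_wmul.
Qed.

Definition push_inf (a : A) (X : nat -> A) : nat -> A :=
  if X 0 == inv a then fun n => X n.+1
  else fun n => if n is m.+1 then X m else a.

Lemma reduced_push_inf a X : reduced_inf X -> reduced_inf (push_inf a X).
Proof.
move=> rX; rewrite /push_inf; case: eqVneq => [_ n|/eqP na [|n]] //; exact: rX.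
Qed.

End Words.

Definition letter (N : nat) : choiceType := ('I_N * bool)%type.
Definition linv N (a : letter N) : letter N := (a.1, ~~ a.2).

Lemma linvK N : involutive (@linv N).
Proof. by case=> i b; rewrite /linv /= negbK. Qed.

Definition free_group (N : nat) : Type := {s : seq (letter N) | reduced (@linv N) s}.
HB.instance Definition _ N := Choice.on (free_group N).

Section FreeGroup.
Variable N : nat.
Implicit Types u v w : free_group N.

Definition fg_one : free_group N := exist _ [::] isT.
Definition fg_mul u v : free_group N :=
  exist _ (wmul (@linv N) (val u) (val v)) (@reduced_wmul _ _ _ _ (valP v)).
Definition fg_inv u : free_group N :=
  exist _ (winv (@linv N) (val u)) (reduced_winv (@linvK N) (valP u)).

Lemma fg_mulA : associative fg_mul.
Proof. by move=> u v w; apply: val_inj; rewrite /= wmulA ?(valP w) //; apply: linvK. Qed.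
Lemma fg_mul1 : left_id fg_one fg_mul.
Proof. by move=> u; apply: val_inj. Qed.
Lemma fg_mulr1 : right_id fg_one fg_mul.
Proof. by move=> u; apply: val_inj; rewrite /= wmuls0 ?(valP u). Qed.
Lemma fg_mulV : left_inverse fg_one fg_inv fg_mul.
Proof.
move=> u; apply: val_inj => /=; rewrite -{2}[val u](wmuls0 (valP u)).
by rewrite wmulVs //; apply: linvK.
Qed.
Lemma fg_mulrV : right_inverse fg_one fg_inv fg_mul.
Proof.
move=> u; rewrite -{1}[u](_ : fg_inv (fg_inv u) = u) ?fg_mulV //.
by apply: val_inj; rewrite /= winvK //; apply: linvK.
Qed.

HB.instance Definition _ := isGroup.Build (free_group N)
  fg_mulA fg_mul1 fg_mulr1 fg_mulV fg_mulrV.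
End FreeGroup.

(* The Gromov boundary of F_N as the set of infinite reduced words. *)
Definition boundary (N : nat) : Type := {X : nat -> letter N | reduced_inf (@linv N) X}.
HB.instance Definition _ N := gen_eqMixin (boundary N).
HB.instance Definition _ N := gen_choiceMixin (boundary N).

Definition cylinder N (w : seq (letter N)) : set (boundary N) :=
  [set X | mkseq (sval X) (size w) = w].

HB.instance Definition _ N :=
  @isSubBaseTopological.Build (boundary N) (set (boundary N)) (range (@cylinder N)) id.

Definition bd_push N (a : letter N) (X : boundary N) : boundary N :=
  exist _ (push_inf (@linv N) a (sval X)) (@reduced_push_inf _ _ a _ (svalP X)).

Definition bd_act N (u : free_group N) (X : boundary N) : boundary N :=
  foldr (@bd_push N) X (val u).

Definition cvg_bd N (u : nat -> free_group N) (X : boundary N) : Prop :=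
  cvg_word (fun n => val (u n)) (sval X).

Record aut (N : nat) := Aut {
  aut_fun :> free_group N -> free_group N;
  aut_bwd : free_group N -> free_group N;
  aut_mul : {morph aut_fun : u v / (u * v)%g};
  aut_funK : cancel aut_fun aut_bwd;
  aut_bwdK : cancel aut_bwd aut_fun }.

Lemma aut_bwd_mul N (phi : aut N) : {morph aut_bwd phi : u v / (u * v)%g}.
Proof.
move=> u v; apply: (can_inj (aut_funK phi)).
by rewrite aut_mul !aut_bwdK.
Qed.

Definition aut_inv N (phi : aut N) : aut N :=
  Aut (aut_bwd_mul phi) (aut_bwdK phi) (aut_funK phi).

Definition outer N (phi : aut N) : set (aut N) :=
  [set psi | exists g, forall u, psi u = (g * phi u * g^-1)%g].

Definition is_basis N (b : 'I_N -> free_group N) : Prop :=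
  bijective (fun w : free_group N =>
    (\prod_(a <- val w) (if a.2 then b a.1 else (b a.1)^-1))%g).

Definition is_subgroup N (K : set (free_group N)) : Prop :=
  [/\ K 1%g, (forall u v, K u -> K v -> K (u * v)%g) & forall u, K u -> K (u^-1)%g].

Definition generated N (B : set (free_group N)) : set (free_group N) :=
  \bigcap_(K in [set K | is_subgroup K /\ B `<=` K]) K.

Definition free_factor N (K : set (free_group N)) : Prop :=
  exists b : 'I_N -> free_group N,
    is_basis b /\ exists S : set 'I_N, K = generated (b @` S).

Definition irreducible_powers N (phi : aut N) : Prop :=
  forall (n : nat) (K : set (free_group N)), (0 < n)%N ->
    free_factor K -> K <> setT -> K <> [set 1%g] ->
    ~ exists g, iter n phi @` K = [set (g * a * g^-1)%g | a in K].

(* Oriented edges: a geometric edge is a pair {e, grev e}. *)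
Record graph := Graph {
  vert : choiceType;
  edge : choiceType;
  org : edge -> vert;
  grev : edge -> edge;
  grevK : involutive grev;
  grev_neq : forall e, grev e != e }.

Record fin_graph := FinGraph {
  fvert : finType;
  fedge : finType;
  forg : fedge -> fvert;
  fgrev : fedge -> fedge;
  fgrevK : involutive fgrev;
  fgrev_neq : forall e, fgrev e != e }.

Coercion graph_of (G : fin_graph) : graph :=
  @Graph (fvert G) (fedge G) (@forg G) (@fgrev G) (@fgrevK G) (@fgrev_neq G).

Section Graphs.
Variable G : graph.
Implicit Types (x y : vert G) (e : edge G) (p : seq (edge G)).

Definition tgt e : vert G := org (grev e).

(* [epath x p]: p is an edge path issued from x; [pend x p] is its endpoint *)
Fixpoint epath x p : bool :=
  if p is e :: p' then (org e == x) && epath (tgt e) p' else true.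
Definition pend x p : vert G := last x (map tgt p).

Definition path_from_to x y p : bool := epath x p && (pend x p == y).

Definition greduced p : bool := reduced (@grev G) p.

Definition grpath p : seq (edge G) := winv (@grev G) p.

Lemma path_push x y e p : org e = x -> path_from_to (tgt e) y p ->
  path_from_to x y (push (@grev G) e p).
Proof.
rewrite /path_from_to /pend => <-; case: p => [|e' p] /=; first by rewrite eqxx.
case/andP=> /andP[/eqP oe' pp] pe; case: eqVneq => [ee'|_] /=; last first.
  by rewrite eqxx oe' eqxx pp.
by move: pp pe; rewrite ee' /tgt grevK => -> /=.
Qed.

Lemma path_wmul x y z p q : path_from_to x y p -> path_from_to y z q ->
  path_from_to x z (wmul (@grev G) p q).
Proof.
elim: p x => [|e p IH] x /=; first by rewrite /path_from_to /pend /= => /eqP->.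
case/andP=> /= /andP[/eqP oe pp] pe pq; apply: path_push => //.
by apply: IH => //; rewrite /path_from_to pp.
Qed.

End Graphs.

(* A map sending vertices to vertices and edges to finite reduced edge paths, *)
(* i.e. a continuous map up to reparametrisation of the image of each edge.   *)
Record graph_map (G G' : graph) := GraphMap {
  vmap :> vert G -> vert G';
  emap : edge G -> seq (edge G');
  emap_path : forall e, path_from_to (vmap (org e)) (vmap (tgt e)) (emap e);
  emap_reduced : forall e, greduced (emap e);
  emap_rev : forall e, emap (grev e) = grpath (emap e) }.

Definition pmap_edge (G G' : graph) (f : graph_map G G') (p : seq (edge G)) :
  seq (edge G') := flatten (map (emap f) p).

(* pi_1(cgraph, cbase) is the set of reduced closed paths at cbase, with the
   product wmul; cpi is an isomorphism onto it. *)
Record chart (N : nat) := Chart {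
  cgraph :> fin_graph;
  cbase : vert cgraph;
  cconn : forall x : vert cgraph, exists p, path_from_to cbase x p;
  cpi : free_group N -> seq (edge cgraph);
  cpi_loop : forall u, path_from_to cbase cbase (cpi u) && greduced (cpi u);
  cpi_mul : forall u v, cpi (u * v)%g = wmul (@grev cgraph) (cpi u) (cpi v);
  cpi_inj : injective cpi;
  cpi_surj : forall p, path_from_to cbase cbase p && greduced p ->
    exists u, cpi u = p }.

Section Cover.
Variables (N : nat) (C : chart N).

(* Vertices of the universal cover: reduced paths issued from the base point. *)
Definition is_cvert (p : seq (edge C)) : bool := epath (cbase C) p && greduced p.
Definition cvert : choiceType := {p : seq (edge C) | is_cvert p}.

Definition cproj (x : cvert) : vert C := pend (cbase C) (val x).

(* the edge (x, e) starts at x and lies above e *)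
Definition is_cedge (xe : cvert * edge C) : bool := org xe.2 == cproj xe.1.
Definition cedge : choiceType := {xe : cvert * edge C | is_cedge xe}.

Definition corg (a : cedge) : cvert := (val a).1.
Definition ceproj (a : cedge) : edge C := (val a).2.

Lemma vert_wmulP x y p (q : seq (edge C)) :
    path_from_to (cbase C) x p -> path_from_to x y q -> greduced q ->
  path_from_to (cbase C) y (wmul (@grev C) p q) &&
  greduced (wmul (@grev C) p q).
Proof. by move=> pp pq rq; rewrite (path_wmul pp pq); apply: reduced_wmul. Qed.

Lemma cvert_path (x : cvert) : path_from_to (cbase C) (cproj x) (val x).
Proof. by have /andP[p _] := valP x; rewrite /path_from_to p eqxx. Qed.

Lemma cvert_reduced (x : cvert) : greduced (val x).
Proof. by have /andP[_] := valP x. Qed.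

Definition ctgt_word (a : cedge) : seq (edge C) :=
  wmul (@grev C) (val (corg a)) [:: ceproj a].

Lemma ctgt_wordP (a : cedge) :
  path_from_to (cbase C) (tgt (ceproj a)) (ctgt_word a) &&
  greduced (ctgt_word a).
Proof.
apply: (vert_wmulP (cvert_path _)) => //.
by rewrite /path_from_to /= [_ == _](valP a) /pend /= eqxx.
Qed.

Lemma ctgt_subproof (a : cedge) : is_cvert (ctgt_word a).
Proof. rewrite /is_cvert; by have /andP[/andP[-> _] ->] := ctgt_wordP a. Qed.

Definition ctgt (a : cedge) : cvert := exist is_cvert _ (ctgt_subproof a).

Lemma cproj_tgt a : cproj (ctgt a) = tgt (ceproj a).
Proof. by have /andP[/andP[_ /eqP]] := ctgt_wordP a. Qed.

Lemma crev_subproof (a : cedge) : is_cedge (ctgt a, grev (ceproj a)).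
Proof. by rewrite /is_cedge /= cproj_tgt. Qed.

Definition crev (a : cedge) : cedge := exist is_cedge _ (crev_subproof a).

Lemma crevK : involutive crev.
Proof.
case=> [[x e] ae]; apply: val_inj; congr pair; last exact: grevK.
apply: val_inj; rewrite /= /ctgt_word /= /ctgt_word /corg /ceproj /=.
have rx := cvert_reduced x.
rewrite (@wmulA _ _ (@grevK C)) //=.
by rewrite eqxx wmuls0.
Qed.

Lemma crev_neq a : crev a != a.
Proof.
apply: contraNneq (grev_neq (ceproj a)) => E.
by rewrite -{2}E.
Qed.

Definition ucover : graph := @Graph cvert cedge corg crev crevK crev_neq.

Lemma dact_subproof (u : free_group N) (x : cvert) :
  path_from_to (cbase C) (cproj x) (wmul (@grev C) (cpi C u) (val x)) &&
  greduced (wmul (@grev C) (cpi C u) (val x)).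
Proof.
have /andP[pu _] := cpi_loop C u.
exact: (vert_wmulP pu (cvert_path x) (cvert_reduced x)).
Qed.

Lemma dact_vert_subproof (u : free_group N) (x : cvert) :
  is_cvert (wmul (@grev C) (cpi C u) (val x)).
Proof. rewrite /is_cvert; by have /andP[/andP[-> _] ->] := dact_subproof u x. Qed.

Definition dact (u : free_group N) (x : vert ucover) : vert ucover :=
  exist is_cvert _ (dact_vert_subproof u x).

Lemma dact_edge_subproof (u : free_group N) (a : edge ucover) :
  is_cedge (dact u (corg a), ceproj a).
Proof.
rewrite /is_cedge /= (_ : forg _ = cproj (corg a)); last exact/eqP/(valP a).
by have /andP[/andP[_]] := dact_subproof u (corg a); rewrite eq_sym.
Qed.

Definition dact_edge (u : free_group N) (a : edge ucover) : edge ucover :=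
  exist is_cedge _ (dact_edge_subproof u a).

Definition cbase_lift : vert ucover := exist is_cvert [::] isT.

(* Ends of the universal cover are infinite reduced paths from the base       *)
(* point. [bd_pi X xi]: xi is the end (partial pi)(X), the limit of the orbit *)
(* of the base point along u_n -> X.                                          *)
Definition bd_pi (X : boundary N) (xi : nat -> edge C) : Prop :=
  [/\ reduced_inf (@grev C) xi, (forall k, epath (cbase C) (mkseq xi k)) &
    forall u : nat -> free_group N, cvg_bd u X ->
      cvg_word (fun n => val (dact (u n) cbase_lift)) xi].

(* the vertices x_n converge to (partial pi)(X) *)
Definition cvg_cover (x : nat -> vert ucover) (X : boundary N) : Prop :=
  exists2 xi, bd_pi X xi & cvg_word (fun n => val (x n)) xi.

Definition is_line (l : boundary N * boundary N) : Prop := l.1 <> l.2.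

(* g is the bi-infinite oriented geodesic [(partial pi)(X), (partial pi)(Y)],  *)
(* parametrised by its successive edges                                       *)
Definition realisation (l : boundary N * boundary N) (g : int -> edge ucover) : Prop :=
  [/\ (forall i : int, org (g (i + 1)) = tgt (g i)),
      (forall i : int, g (i + 1) <> grev (g i)),
      cvg_cover (fun n : nat => org (g (- n%:Z))) l.1 &
      cvg_cover (fun n : nat => org (g n%:Z)) l.2].

Definition cyl_path (gamma : seq (edge ucover)) : set (boundary N * boundary N) :=
  [set l | is_line l /\ exists g, realisation l g /\
     exists k : int, gamma = mkseq (fun j : nat => g (k + j%:Z)) (size gamma)].

(* f induces the outer class of phi through cpi, hence is a homotopy          *)
(* equivalence                                                                *)
Definition induces (f : graph_map C C) (phi : aut N) : Prop :=
  exists2 psi, outer phi psi & exists2 q, path_from_to (cbase C) (f (cbase C)) q &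
    forall u, cpi C (psi u) =
      wred (@grev C) (q ++ pmap_edge f (cpi C u) ++ grpath q).

Definition associated_lift (f : graph_map C C) (phi : aut N)
    (ft : graph_map ucover ucover) : Prop :=
  [/\ (forall x, cproj (ft x) = f (cproj x)),
      (forall a, map ceproj (emap ft a) = emap f (ceproj a)),
      (forall u x, ft (dact u x) = dact (phi u) (ft x)) &
      (forall u a, emap ft (dact_edge u a) = map (dact_edge (phi u)) (emap ft a))].

Definition is_train_track (f : graph_map C C) : Prop :=
  forall (n : nat) (e : edge C), (0 < n)%N ->
    let p := iter n (pmap_edge f) [:: e] in p <> [::] /\ greduced p.

(* a non-trivial subgraph is neither the whole graph nor a set of vertices *)
Definition is_irreducible_map (f : graph_map C C) : Prop :=
  (forall v : fvert C, #|[set e : fedge C | forg e == v]%SET| \notin [:: 1; 2]%N) /\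
  (forall S : {set fedge C},
     (forall e, e \in S -> fgrev e \in S) ->
     (forall e, e \in S -> {subset (emap f e : seq (fedge C)) <= S}) ->
     S = finset.set0 \/ S = [set: fedge C]%SET).

Definition irreducible_train_track (phi : aut N) (f : graph_map C C) : Prop :=
  [/\ induces f phi, is_train_track f & is_irreducible_map f].

(* O selects one orientation of each geometric edge *)
Definition is_orientation (O : {set fedge C}) : Prop :=
  forall e, (e \in O) = (fgrev e \notin O).

Definition transition_matrix (R : realType) (f : graph_map C C)
    (O : {set fedge C}) : 'M[R]_#|O| :=
  \matrix_(i, j) (count (fun a : fedge C => (a == enum_val i) ||
      (a == fgrev (enum_val i))) (emap f (enum_val j)))%:R.

(* By the Perron-Frobenius theorem an irreducible non-negative matrix has a
   single eigenvalue with a positive eigenvector. The entry (i, j) counts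
   occurrences of e_i in f(e_j), so v is a vector of edge lengths. *)
Definition perron_frobenius (R : realType) n (M : 'M[R]_n) (lam : R) : Prop :=
  exists v : 'rV[R]_n, [/\ v != 0, forall i, 0 < v 0 i & v *m M = lam *: v].

(* The attracting lamination, computed with f and the edge e0 of the cover.   *)
(* Any lift of f associated with an automorphism of the outer class may be    *)
(* used: the choice is absorbed by the translations u_n.                      *)
Definition attracting_lamination (phi : aut N) (f : graph_map C C)
    (e0 : edge ucover) : set (boundary N * boundary N) :=
  [set l | is_line l /\
    exists psi ft, [/\ outer phi psi, associated_lift f psi ft &
    exists (eps : bool) (u : nat -> free_group N),
      let e := if eps then e0 else grev e0 in
      cvg_cover (fun n => dact (u n) (iter n ft (org e))) l.1 /\
      cvg_cover (fun n => dact (u n) (iter n ft (tgt e))) l.2]].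

Definition decomposition (ft : graph_map ucover ucover) (e : edge ucover) :
    set (edge ucover * seq (edge ucover) * seq (edge ucover)) :=
  [set t | [/\ (exists x, epath x (t.1.2 ++ e :: t.2)),
     greduced (t.1.2 ++ e :: t.2) & emap ft t.1.1 = t.1.2 ++ e :: t.2]].

End Cover.

Definition expansion_factor (R : realType) N (phi : aut N) (lam : R) : Prop :=
  exists (C : chart N) (f : graph_map C C) (O : {set fedge C}),
    [/\ irreducible_train_track phi f, is_orientation O &
        perron_frobenius (transition_matrix R f O) lam].

Section MetricTrees.
Variables (R : realType) (X : metricType R).

Definition geodesic_space : Prop := forall x y : X, exists c : R -> X,
  [/\ c 0 = x, c (mdist x y) = y &
    forall s t, 0 <= s <= mdist x y -> 0 <= t <= mdist x y ->
      mdist (c s) (c t) = `|s - t|].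

Definition zero_hyperbolic : Prop := forall x y z w : X,
  mdist x z + mdist y w <=
    Num.max (mdist x y + mdist z w) (mdist x w + mdist y z).

Definition Rtree : Prop := geodesic_space /\ zero_hyperbolic.

Definition between (x y z : X) : Prop := mdist x z = mdist x y + mdist y z.

(* geodesic rays; only the restriction to [0, +oo[ matters *)
Definition is_ray (r : R -> X) : Prop :=
  forall s t, 0 <= s -> 0 <= t -> mdist (r s) (r t) = `|s - t|.

Definition asymptotic (r r' : R -> X) : Prop :=
  exists B, forall t, 0 <= t -> mdist (r t) (r' t) <= B.

Definition ray_class (r : R -> X) : set (R -> X) :=
  [set r' | is_ray r' /\ asymptotic r r'].

Definition is_end (A : set (R -> X)) : Prop := exists2 r, is_ray r & A = ray_class r.

Definition hat : Type := (X + {A : set (R -> X) | is_end A})%type.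

HB.instance Definition _ := gen_eqMixin hat.
HB.instance Definition _ := gen_choiceMixin hat.

(* points of [hat] that r(0) sees strictly behind r(t) *)
Definition shadow (r : R -> X) (t : R) : set hat :=
  [set P | match P with
     | inl y => exists2 s, t < s & between (r 0) (r s) y
     | inr A => exists2 s, t < s & exists2 r', sval A r' & r' 0 = r 0 /\ r' s = r s
     end].

(* The open balls of X and the shadows generate the metric topology of X
   extended to its Gromov boundary. Connected components below are taken for
   this topology, while [obs] carries the one they generate. *)
Definition hat_subbase : set (set hat) :=
  [set U | (exists (x : X) (eps : R), U = inl @` ball x eps) \/
           (exists (r : R -> X) (t : R), [/\ is_ray r, 0 <= t & U = shadow r t])].

HB.instance Definition _ :=
  @isSubBaseTopological.Build hat (set hat) hat_subbase id.

Definition obs : Type := hat.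
HB.instance Definition _ := Choice.on obs.

Definition directions : set (set obs) :=
  [set U | exists P Q : hat, Q <> P /\ U = connected_component (~` [set P]) Q].

HB.instance Definition _ :=
  @isSubBaseTopological.Build obs (set obs) directions id.

Definition is_complete : Prop :=
  forall F : set_system X, ProperFilter F -> cauchy F ->
    exists x : X, F --> x.

Definition homothety (c : R) (h : X -> X) : Prop :=
  (forall x y, mdist (h x) (h y) = c * mdist x y) /\ (forall y, exists x, h x = y).

End MetricTrees.

Record Ftree (R : realType) (N : nat) := FTree {
  tsp :> metricType R;
  tact : free_group N -> tsp -> tsp;
  tact1 : forall x, tact 1%g x = x;
  tactM : forall u v x, tact (u * v)%g x = tact u (tact v x);
  tact_isom : forall u x y, mdist (tact u x) (tact u y) = mdist x y;
  tree_nonempty : [set: tsp] !=set0;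
  tree_Rtree : Rtree tsp }.

Section Ftrees.
Variables (R : realType) (N : nat).
Implicit Types T S : Ftree R N.

Lemma end_act_subproof T (u : free_group N) (A : set (R -> T)) :
  is_end A -> is_end [set (fun t => tact u (r t)) | r in A].
Proof.
case=> r rr ->; exists (fun t => tact u (r t)).
  by move=> s t s0 t0; rewrite tact_isom; apply: rr.
apply/seteqP; split=> [_ [r' [rr' [B hB]] <-]|r' [rr' [B hB]]].
  split; first by move=> s t s0 t0; rewrite tact_isom; apply: rr'.
  by exists B => t t0; rewrite tact_isom; apply: hB.
exists (fun t => tact u^-1%g (r' t)); last first.
  by apply/funext => t; rewrite -tactM mulgV tact1.
split; first by move=> s t s0 t0; rewrite tact_isom; apply: rr'.
exists B => t t0; rewrite -(@tact_isom _ _ T u) -tactM mulgV tact1; exact: hB.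
Qed.

Definition hat_act T (u : free_group N) (P : hat T) : hat T :=
  match P with
  | inl x => inl (tact u x)
  | inr A => inr (exist _ _ (end_act_subproof u (svalP A)))
  end.

Definition translation_length T (u : free_group N) : R :=
  inf [set mdist x (tact u x) | x in [set: T]].

Definition is_subtree T (A : set T) : Prop :=
  A !=set0 /\ forall x y z, A x -> A z -> between x y z -> A y.

Definition minimal T : Prop := forall A : set T,
  is_subtree A -> (forall u x, A x -> A (tact u x)) -> A = setT.

Definition very_small T : Prop :=
  [/\ (* arc stabilisers are cyclic *)
      (forall x y : T, x <> y -> exists c, forall u,
         tact u x = x -> tact u y = y ->
         exists n : nat, u = (c ^+ n)%g \/ u = (c ^- n)%g),
      (* fixed sets of non-trivial elements contain no tripod *)
      (forall u (x y z : T), u <> 1%g ->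
         tact u x = x -> tact u y = y -> tact u z = z ->
         [\/ between x y z, between y z x | between z x y]) &
      (* roots of elliptic elements have the same fixed set *)
      (forall u n (x : T), u <> 1%g -> (0 < n)%N ->
         tact (u ^+ n)%g x = x -> tact u x = x)].

Definition in_outer_space T : Prop :=
  [/\ minimal T, very_small T & ~ exists x : T, forall u, tact u x = x].

Definition twisted_equivariant T (phi : aut N) (h : T -> T) : Prop :=
  forall u x, h (tact u x) = tact (phi u) (h x).

Definition fixes_class T (phi : aut N) : Prop :=
  exists (c : R) (h : T -> T), [/\ 0 < c, homothety c h & twisted_equivariant phi h].

(* Convergence of projective classes is convergence of the translation length *)
(* functions up to scaling. The outer class of phi acts by                    *)
(* |u| |-> |phi(u)|, which is the convention under which the twisted          *)
(* homothety of the repelling tree is contracting.                            *)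
Definition repelling_tree T (phi : aut N) : Prop :=
  [/\ in_outer_space T, fixes_class T phi &
    forall S, in_outer_space S -> ~ fixes_class S phi ->
      exists2 c : nat -> R, (forall n, 0 < c n) &
        forall u, (fun n => c n * translation_length S (iter n (aut_inv phi) u))
                    @ \oo --> translation_length T u].

Definition is_completion T (Tb : Ftree R N) (i : T -> Tb) : Prop :=
  [/\ (forall x y, mdist (i x) (i y) = mdist x y),
      (forall u x, i (tact u x) = tact u (i x)),
      dense (range i) & is_complete Tb].

Definition associated_homothety (Tb : Ftree R N) (phi : aut N) (H : Tb -> Tb) : Prop :=
  exists2 lam, expansion_factor (aut_inv phi) lam &
    homothety lam^-1 H /\ twisted_equivariant phi H.

Definition is_Qmap (Tb : Ftree R N) (Q : boundary N -> obs Tb) : Prop :=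
  [/\ (forall u X, Q (bd_act u X) = hat_act u (Q X)),
      continuous Q &
      forall (x : Tb) (u : nat -> free_group N) (X : boundary N), cvg_bd u X ->
        (fun n => inl (tact (u n) x) : obs Tb) @ \oo --> Q X].

Definition dual_lamination (Tb : Ftree R N) (Q : boundary N -> obs Tb) :
    set (boundary N * boundary N) :=
  [set l | is_line l /\ Q l.1 = Q l.2].

(* The image of C_e under Q^2. Both the inclusion of the attracting           *)
(* lamination in the dual one and the fact that Q^2 takes its values in Tb    *)
(* are theorems, so intersecting with the dual lamination and taking the      *)
(* trace on Tb lose nothing.                                                  *)
Definition Omega (Tb : Ftree R N) (Q : boundary N -> obs Tb) (C : chart N)
    (L : set (boundary N * boundary N)) (e : edge (ucover C)) : set Tb :=
  [set x | exists2 l, (cyl_path [:: e] `&` L `&` dual_lamination Q) l &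
     Q l.1 = inl x].

End Ftrees.

(* Main.v *)
(* Write d(phi) for the action of phi on the boundary. A line of the attracting
   lamination is a limit of u_n ft^n(e0), so it is the image by d(phi) of the
   limit of phi^-1(u_{n+1}) ft^n(e0), and conversely. An edge e lies on the line
   (X, Y) iff removing e separates X from Y, which can be read off any two
   sequences of vertices converging to X and Y; since the paths u_n ft^n(e0) are
   reduced and ft maps them to reduced paths, e lies on d(phi)(l) iff some
   edge e' of l has e in ft(e'). Finally Q(d(phi) X) = H(Q X) because a
   homothety preserves betweenness and the observers' topology separates points.
   Two lifts of f differ by a deck transformation d, and the two homotheties H
   and d^-1 H' agree on the image of Q. *)
Require Import Defs.
From HB Require Import structures.
From mathcomp Require Import all_boot all_order all_algebra.
From mathcomp Require Import all_classical all_reals.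
From mathcomp Require Import all_analysis.
From mathcomp Require Import lra.
Set Implicit Arguments.
Unset Strict Implicit.
Unset Printing Implicit Defensive.
Import Order.TTheory GRing.Theory Num.Theory.
Import numFieldNormedType.Exports.
Local Open Scope classical_set_scope.
Local Open Scope ring_scope.

(** * Words and ends of trees *)

(** Limits come in two languages: [Q] is controlled along sequences of $F_N$, whereas laminations
    and cylinders are described by sequences of vertices of the cover. They are matched by a coarse
    section of the orbit map: every vertex is [G x] applied to one of finitely many representatives.
    A map of the cover twisted by [phi] therefore stays at bounded distance from [phi] on $F_N$, and
    a single boundary point serves as limit in both languages.

    In the inclusion of [Om e] in the union, the edge $e'$ whose image crosses [e] depends on the
    index [n] of the approximating path. Finiteness of the decomposition yields one $e'$ that occurs
    for infinitely many [n]. This is enough, because the side of an edge on which a convergent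
    sequence lies is eventually constant.

    The homothety is defined on points only, not on ends, and no continuity of it for the observers'
    topology is at hand. Its compatibility with [Q] is obtained from one separating point [M] and
    its preimage under the homothety. *)

Section Words.
Variables (A : eqType) (inv : A -> A).
Hypothesis invK : involutive inv.
Implicit Types s t q : seq A.
Notation wmul := (wmul inv).
Notation winv := (winv inv).
Notation reduced := (reduced inv).

Lemma wmul_reduced_cat s t : reduced (s ++ t) -> wmul s t = s ++ t.
Proof.
elim: s => //= a s IH rs; rewrite IH ?push_id //; exact: path_sorted rs.
Qed.

Lemma reduced_take k s : reduced s -> reduced (take k s).
Proof. by rewrite -{1}(cat_take_drop k s) /reduced => /cat_sorted2[]. Qed.

Lemma wmul1s a s : reduced (a :: s) -> wmul [:: a] s = a :: s.
Proof. by move=> r; rewrite /= push_id. Qed.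

Lemma size_push a s : (size (push inv a s) <= (size s).+1)%N.
Proof. by case: s => //= b s; case: eqVneq => //= _; rewrite ltnW. Qed.

Lemma size_wmul s t : (size (wmul s t) <= size s + size t)%N.
Proof.
by elim: s => //= a s IH; apply: leq_trans (size_push _ _) _; rewrite addSn ltnS.
Qed.

Lemma wmulsV s t : reduced t -> wmul s (wmul (winv s) t) = t.
Proof. by move=> rt; rewrite -{1}[s](winvK invK) wmulVs. Qed.

Lemma wmulVs0 s : reduced s -> wmul (winv s) s = [::].
Proof. by move=> rs; rewrite -[X in wmul _ X](wmuls0 rs) wmulVs. Qed.

Lemma wmulKs s t : reduced s -> reduced t -> wmul (wmul s t) (winv t) = s.
Proof.
move=> rs rt; rewrite wmulA ?reduced_winv // -[winv t in X in wmul s X](wmuls0 (inv := inv)) ?reduced_winv //.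
by rewrite wmulsV // wmuls0.
Qed.

Lemma wmul_injl t s1 s2 : reduced s1 -> reduced s2 -> reduced t ->
  wmul s1 t = wmul s2 t -> s1 = s2.
Proof. by move=> r1 r2 rt e; rewrite -(wmulKs r1 rt) e wmulKs. Qed.

Lemma wmul_injr s t1 t2 : reduced t1 -> reduced t2 ->
  wmul s t1 = wmul s t2 -> t1 = t2.
Proof. by move=> r1 r2 e; rewrite -(wmulVs invK s r1) e wmulVs. Qed.

Lemma size_wmul_ge s q : reduced s -> reduced q ->
  (size s <= size (wmul s q) + size q)%N.
Proof.
move=> rs rq; rewrite -{1}(wmulKs rs rq).
by apply: leq_trans (size_wmul _ _) _; rewrite size_rev size_map.
Qed.

Lemma reduced_rcons s a b : reduced (rcons s a) -> b != inv a ->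
  reduced (rcons (rcons s a) b).
Proof.
case: s => [|c s] /=; first by rewrite andbT.
by rewrite !rcons_path => -> /=; rewrite last_rcons.
Qed.

Lemma wmul_letter s b : reduced s ->
  wmul s [:: b] = rcons s b \/ exists2 s', s = rcons s' (inv b) & wmul s [:: b] = s'.
Proof.
case/lastP: s => [|s a] rs; first by left.
rewrite -cats1 wmul_cat /=; case: (eqVneq b (inv a)) => [->|nb].
  right; exists s; first by rewrite invK cats1.
  by rewrite wmuls0 //; move: rs; rewrite /reduced -cats1 => /cat_sorted2[].
left; rewrite wmul_reduced_cat ?cats1 -?cats1 -?catA //.
by rewrite -[[:: a; b]]/([:: a] ++ [:: b]) catA !cats1 reduced_rcons.
Qed.

Lemma take_wmul_letter k s b : reduced s -> (k < size s)%N ->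
  take k (wmul s [:: b]) = take k s.
Proof.
move=> rs; case: (wmul_letter b rs) => [->|[s' -> ->]].
  by move=> ks; rewrite -cats1 takel_cat // ltnW.
by rewrite size_rcons ltnS => ks; rewrite -cats1 takel_cat.
Qed.

(** Each letter of [q] cancels at most one letter at the end of [s], so only the last [size q]
    letters of [s] are at risk. *)
Lemma take_wmul k s q : reduced s -> reduced q -> (k + size q <= size s)%N ->
  take k (wmul s q) = take k s.
Proof.
elim: q s => [|b q IH] s rs rq; first by rewrite wmuls0.
rewrite /= addnS => ks.
have rq' : reduced q by apply: path_sorted rq.
rewrite -(wmul1s rq) -wmulA // IH ?take_wmul_letter //.
- by apply: leq_trans ks; rewrite ltnS leq_addr.
- exact: reduced_wmul.
have /= := @size_wmul_ge s [:: b] rs isT; rewrite addn1 => h.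
by rewrite -ltnS (leq_trans ks).
Qed.

Lemma cvg_word_unique (w : nat -> seq A) (X Y : nat -> A) :
  cvg_word w X -> cvg_word w Y -> X = Y.
Proof.
move=> wX wY; apply/funext => k.
have [n _ hX] := wX k.+1; have [m _ hY] := wY k.+1.
move: (hX (maxn n m) (leq_maxl _ _)) (hY (maxn n m) (leq_maxr _ _)) => {}hX {}hY.
have := congr1 (fun s => nth (X k) s k) (etrans (esym hX) hY).
by rewrite !nth_mkseq.
Qed.

Lemma cvg_word_mkseq (X : nat -> A) : cvg_word (mkseq X) X.
Proof.
by move=> k; exists k => //= n /= kn; rewrite /mkseq -map_take take_iota (minn_idPl kn).
Qed.

Lemma cvg_word_shift w (X : nat -> A) : cvg_word w X -> cvg_word (fun n => w n.+1) X.
Proof. by move=> wX k; have [n _ h] := wX k; exists n => //= m nm; apply: h; exact: leqW. Qed.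

Lemma cvg_word_shiftV w (X : nat -> A) : cvg_word (fun n => w n.+1) X -> cvg_word w X.
Proof. by move=> wX k; have [n _ h] := wX k; exists n.+1 => //= -[//|m] nm; apply: h. Qed.

Lemma size_take_mkseq k s (X : nat -> A) : take k s = mkseq X k -> (k <= size s)%N.
Proof. by move/(congr1 size); rewrite size_take_min size_mkseq => /minn_idPl. Qed.

Lemma take_mkseq_le j k s (X : nat -> A) :
  take k s = mkseq X k -> (j <= k)%N -> take j s = mkseq X j.
Proof.
move=> e jk; rewrite -(take_takel s jk) e /mkseq -map_take take_iota.
by rewrite (minn_idPl jk).
Qed.

(** Moving each term by a bounded distance does not change the end to which a sequence converges:
    the loss is [K] letters, so closeness up to [k + K] is asked of [w]. *)
Lemma cvg_word_wmul K (w q : nat -> seq A) X :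
  (forall n, reduced (w n)) -> (forall n, reduced (q n)) ->
  (forall n, (size (q n) <= K)%N) ->
  cvg_word w X -> cvg_word (fun n => wmul (w n) (q n)) X.
Proof.
move=> rw rq sq wX k; have [m _ h] := wX (k + K)%N.
exists m => //= n /h e; rewrite take_wmul //.
  by apply: take_mkseq_le e _; rewrite leq_addr.
by apply: leq_trans (size_take_mkseq e); rewrite leq_add2l.
Qed.

Lemma cvg_word_reduced (w : nat -> seq A) X :
  (forall n, reduced (w n)) -> cvg_word w X -> reduced_inf inv X.
Proof.
move=> rw wX n; have [m _ h] := wX n.+2.
have := reduced_take n.+2 (rw m); rewrite (h m (leqnn m)).
move=> /(sortedP (X 0%N)); rewrite size_mkseq => /(_ n (ltnSn _)).
by rewrite !nth_mkseq // => /eqP.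
Qed.

Lemma reduced_mkseq (X : nat -> A) n : reduced_inf inv X -> reduced (mkseq X n).
Proof.
move=> rX; apply/(sortedP (X 0%N)) => i; rewrite size_mkseq => hi.
by rewrite !nth_mkseq ?(ltnW hi) //; apply/eqP.
Qed.

End Words.

(* A Lipschitz proper map between trees extends to the ends: beyond a large
   radius its jumps stay outside a ball around the root, so they cannot leave
   the subtree they start in. *)
Lemma lipschitz_proper_extension (A B : eqType) (inv : B -> B)
    (D : set (seq A)) (F : seq A -> seq B) (K : nat) :
  involutive inv ->
  (forall w, D w -> reduced inv (F w)) ->
  (forall w a, D (rcons w a) -> exists q,
     [/\ reduced inv q, (size q <= K)%N & F (rcons w a) = wmul inv (F w) q]) ->
  (forall w k, D w -> D (take k w)) ->
  (forall k, exists m, forall w, D w -> (m <= size w)%N -> (k <= size (F w))%N) ->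
  forall X, (forall k, D (mkseq X k)) ->
  exists Y, forall w, (forall n, D (w n)) -> cvg_word w X ->
    cvg_word (fun n => F (w n)) Y.
Proof.
move=> invK redF lipF takeD /choice[m properF] X DX.
(* Induction on the last letter: [F w] has length at least [k + K] by properness, and the jump [q]
   only affects its last [K] letters. *)
have stable k w : D w -> (m (k + K) <= size w)%N ->
    take k (F w) = take k (F (take (m (k + K)) w)).
  elim/last_ind: w => [|w a IH] Dw; first by [].
  rewrite size_rcons leq_eqVlt => /predU1P[->|].
    by rewrite -[X in take X (rcons w a)](size_rcons w a) take_size.
  rewrite ltnS => mw; have Dw' : D w.
    by have := takeD _ (size w) Dw; rewrite -cats1 takel_cat // take_size.
  have [q [rq sq ->]] := lipF _ _ Dw.
  rewrite take_wmul ?redF //; last first.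
    by apply: leq_trans (properF _ _ Dw' mw); rewrite leq_add2l.
  by rewrite IH // -cats1 takel_cat.
pose W k := F (mkseq X (m (k + K))).
have W_size k : (k <= size (W k))%N.
  by apply: leq_trans (leq_addr K k) _; apply: properF; rewrite ?size_mkseq.
have stableW k w : D w -> take (m (k + K)) w = mkseq X (m (k + K)) ->
    take k (F w) = take k (W k).
  by move=> Dw e; rewrite stable ?e //; exact: size_take_mkseq e.
(* The words [take j (W j)] are nested: up to any [k] they are prefixes of the image of one long
   prefix of [X]. Their last letters therefore spell one infinite word. *)
have far k : exists n, forall j, (j <= k)%N -> take j (F (mkseq X n)) = take j (W j).
  exists (\max_(j < k.+1) m (j + K)) => j jk.
  apply: stableW => //; apply: take_mkseq_le (leqnn _).
  rewrite /mkseq -map_take take_iota (minn_idPl _) //.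
  by rewrite -[j]/(val (Ordinal (jk : (j < k.+1)%N))) leq_bigmax.
(* The alphabet [B] is not assumed inhabited; the default letter for [nth] is taken from [W 1],
   which has at least one letter. *)
have [b _] : exists b : B, True.
  by have := W_size 1; case: (W 1) => // b _ _; exists b.
exists (fun k => nth b (W k.+1) k) => w Dw wX k.
have [n _ h] := wX (m (k + K)); exists n => //= i ni.
rewrite stableW ?h //.
have [n' h'] := far k.
have sW : size (take k (F (mkseq X n'))) = k.
  by rewrite h' // size_takel.
rewrite -h' //; apply: (@eq_from_nth _ b); first by rewrite sW size_mkseq.
move=> j; rewrite sW => jk; rewrite nth_mkseq // nth_take //.
have -> : nth b (W j.+1) j = nth b (take j.+1 (W j.+1)) j by rewrite nth_take.
by rewrite -h' // nth_take.
Qed.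

Lemma finite_words (A : finType) k : finite_set [set s : seq A | (size s < k)%N].
Proof.
apply: (@sub_finite_set _ _ (@bseqval k A @` [set: k.-bseq A])).
  by move=> s /= sk; exists (Bseq (ltnW sk)).
exact: finite_image.
Qed.

Lemma finite_set_inj_on T U (A : set T) (B : set U) (f : T -> U) :
  {in A &, injective f} -> f @` A `<=` B -> finite_set B -> finite_set A.
Proof.
move=> fI fAB finB; rewrite -(eq_finite_set (inj_card_eq fI)).
exact: sub_finite_set finB.
Qed.

(** Only finitely many words have a short image, since [F] together with a colour in the finite type
    [V] is injective; [m] exceeds their lengths. The colour allows for maps that are merely
    finite-to-one. *)
Lemma proper_finite_to_one (A B : choiceType) (V : finType) (D : set (seq A))
    (F : seq A -> seq B) (c : seq A -> V) :
  (forall k, finite_set [set s : seq B | (size s < k)%N]) ->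
  (forall w w', D w -> D w' -> F w = F w' -> c w = c w' -> w = w') ->
  forall k, exists m, forall w, D w -> (m <= size w)%N -> (k <= size (F w))%N.
Proof.
move=> finB injF k.
have fin : finite_set (D `&` [set w | (size (F w) < k)%N]).
  apply: (@finite_set_inj_on _ _ _ ([set s : seq B | (size s < k)%N] `*` [set: V])
    (fun w => (F w, c w))).
  - by move=> w w' /[!inE] -[Dw _] [Dw' _] [/injF]; apply.
  - by move=> _ [w [_ wk] <-].
  - exact: finite_setX (finB k) finite_finset.
have [s sE] := (finite_seqP _).1 fin.
exists (\max_(w <- s) size w).+1 => w Dw; apply: contraTT; rewrite -!ltnNge => wk.
rewrite ltnS; apply: leq_bigmax_seq => //.
have : [set` s] w by rewrite -sE.
by [].
Qed.

(** * The boundary of the free group and of the universal cover *)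

Section FreeGroupBoundary.
Variable N : nat.

Lemma reduced_letters (u : free_group N) : reduced (@linv N) (val u).
Proof. exact: (valP u). Qed.

Lemma boundary_approx (X : boundary N) : exists u, cvg_bd u X.
Proof.
exists (fun n => exist (fun s => reduced (@linv N) s) _ (reduced_mkseq n (svalP X))).
exact: cvg_word_mkseq.
Qed.

Lemma cvg_bd_unique u X Y : @cvg_bd N u X -> cvg_bd u Y -> X = Y.
Proof.
move=> uX uY; have := cvg_word_unique uX uY.
by case: X Y {uX uY} => [X rX] [Y rY] /= e; subst Y; congr exist; exact: Prop_irrelevance.
Qed.

(* An injective morphism out of [F_N] is proper, alphabets being finite. *)
Lemma morphism_extension (B : choiceType) (inv : B -> B) (F : free_group N -> seq B) :
  involutive inv -> (forall k, finite_set [set s : seq B | (size s < k)%N]) ->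
  (forall u, reduced inv (F u)) -> {morph F : u v / (u * v)%g >-> wmul inv u v} ->
  injective F ->
  forall X : boundary N, exists2 Y, reduced_inf inv Y &
    forall u, cvg_bd u X -> cvg_word (fun n => F (u n)) Y.
Proof.
move=> invK finB redF FM Finj X.
(* The extension result concerns maps on words, so [F] is carried over to them, with a junk value on
   words that are not reduced. *)
pose F' (s : seq (letter N)) := if insub s is Some u then F u else [::].
have F'E (u : free_group N) : F' (val u) = F u by rewrite /F' valK.
pose D := [set s | reduced (@linv N) s].
have DE s : D s -> exists u : free_group N, s = val u by move=> rs; exists (exist (fun s => reduced (@linv N) s) s rs).
pose gen (a : letter N) : free_group N := exist (fun s => reduced (@linv N) s) [:: a] isT.
have [Y hY] : exists Y, forall w, (forall n, D (w n)) -> cvg_word w (sval X) ->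
    cvg_word (fun n => F' (w n)) Y.
  apply: (@lipschitz_proper_extension _ _ inv D F'
    (\max_(a : 'I_N * bool) size (F (gen a)))) => //.
  - by move=> s /DE[u ->]; rewrite F'E.
  - move=> s a rsa; have rs : D s by move: rsa; rewrite /D /= /reduced -cats1 => /cat_sorted2[].
    have [u su] := DE _ rs; exists (F (gen a)); split => //.
      exact: (leq_bigmax (a : 'I_N * bool)).
    rewrite su F'E -FM -F'E; congr F'; rewrite /= -su.
    by rewrite wmul_reduced_cat ?cats1.
  - by move=> s k; exact: reduced_take.
  - apply: (@proper_finite_to_one _ _ unit D F' (fun=> tt) finB) => s s' /DE[u ->] /DE[v ->].
    by rewrite !F'E => /Finj ->.
  - by move=> k; exact: reduced_mkseq (svalP X).
have FY u : cvg_bd u X -> cvg_word (fun n => F (u n)) Y.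
  move=> uX; have := hY (fun n => val (u n)) (fun n => reduced_letters (u n)) uX.
  by under eq_fun do rewrite F'E.
exists Y => //; have [u uX] := boundary_approx X.
exact: cvg_word_reduced (fun n => redF (u n)) (FY u uX).
Qed.

Lemma aut_extension (phi : aut N) (X : boundary N) :
  exists Y : boundary N, forall u, cvg_bd u X -> cvg_bd (fun n => phi (u n)) Y.
Proof.
have [Y rY hY] := @morphism_extension (letter N) (@linv N) (fun u => val (phi u))
  (@linvK N) (@finite_words ('I_N * bool)%type)
  (fun u => reduced_letters (phi u)) (fun u v => congr1 val (aut_mul phi u v))
  (fun u v e => can_inj (aut_funK phi) (val_inj e)) X.
by exists (exist _ Y rY).
Qed.

Lemma aut_one (phi : aut N) : phi 1%g = 1%g.
Proof. by apply: (mulgI (phi 1%g)); rewrite -aut_mul !mulg1. Qed.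

End FreeGroupBoundary.

Section Charts.
Variables (N : nat) (C : chart N).
Implicit Types (x y : vert (ucover C)) (a b : edge (ucover C)).
Notation gr := (@grev C).
Notation grK := (@grevK C).

Lemma cpi_reduced u : reduced gr (cpi C u).
Proof. by have /andP[] := cpi_loop C u. Qed.

Lemma vert_reduced x : reduced gr (val x).
Proof. exact: (cvert_reduced (C := C) x). Qed.

Lemma cpi1 : cpi C 1%g = [::].
Proof.
apply: (@wmul_injr _ gr grK (cpi C 1%g)); rewrite ?cpi_reduced //.
by rewrite -cpi_mul mulg1 wmuls0 ?cpi_reduced.
Qed.

Lemma dact1 x : dact 1%g x = x.
Proof. by apply: val_inj; rewrite /= cpi1. Qed.

Lemma dactM u v x : dact (u * v)%g x = dact u (dact v x).
Proof. by apply: val_inj; rewrite /= cpi_mul wmulA ?vert_reduced //; exact: grK. Qed.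

Lemma dact_free u v x : dact u x = dact v x -> u = v.
Proof.
move/(congr1 val) => /= e; apply: (@cpi_inj _ C).
exact: (@wmul_injl _ gr grK (val x)) (cpi_reduced u) (cpi_reduced v) (vert_reduced x) e.
Qed.

Lemma cproj_dact u x : cproj (dact u x) = cproj x.
Proof. by have /andP[/andP[_ /eqP]] := dact_subproof u x. Qed.

Lemma dact_base u : val (dact u (cbase_lift C)) = cpi C u.
Proof. by rewrite /= wmuls0 // cpi_reduced. Qed.

Lemma path_from_to_cat (G : graph) (x y z : vert G) p q :
  path_from_to x y p -> path_from_to y z q -> path_from_to x z (p ++ q).
Proof.
rewrite /path_from_to /pend => /andP[].
elim: p x => [|e p IH] x /=; first by move=> _ /eqP ->.
by case/andP=> -> pp ey qz /=; exact: IH.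
Qed.

Lemma path_from_to_rev (G : graph) (x y : vert G) p :
  path_from_to x y p -> path_from_to y x (grpath p).
Proof.
elim: p x => [|e p IH] x.
  by rewrite /path_from_to /grpath /pend /= eq_sym.
rewrite /path_from_to /= => /andP[/andP[/eqP <- pp] pe].
rewrite /grpath winv_cons -cats1; apply: (path_from_to_cat (IH (tgt e) _)).
  by rewrite /path_from_to pp.
by rewrite /path_from_to /pend /= /tgt grevK !eqxx.
Qed.

(** The path to [x] followed by the inverse of the path to [y] is a loop at the base point, hence
    the loop of some [u]. *)
Lemma deck_transitive x y : cproj x = cproj y -> exists u, x = dact u y.
Proof.
move=> xy.
have := path_wmul (cvert_path x); rewrite xy => /(_ _ _ (path_from_to_rev (cvert_path y))).
have r : greduced (wmul gr (val x) (grpath (val y))).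
  exact/(reduced_wmul _)/(reduced_winv grK)/vert_reduced.
move=> p; have [u uE] := @cpi_surj _ C _ (introT andP (conj p r)).
exists u; apply: val_inj => /=; rewrite uE.
rewrite wmulA ?vert_reduced //; last exact: grK.
by rewrite wmulVs0 ?wmuls0 ?vert_reduced //; exact: grK.
Qed.

Lemma edge_ext a b : corg a = corg b -> ceproj a = ceproj b -> a = b.
Proof.
by case: a b => [[x e] p] [[y f] q] /= xy ef; apply: val_inj => /=; congr pair.
Qed.

Lemma ctgt_dact u a : ctgt (dact_edge u a) = dact u (ctgt a).
Proof. by apply: val_inj; rewrite /= /ctgt_word /= wmulA //; exact: grK. Qed.

Lemma dact_edge1 a : dact_edge 1%g a = a.
Proof. by apply: edge_ext => //; exact: dact1. Qed.

Lemma dact_edgeM u v a : dact_edge (u * v)%g a = dact_edge u (dact_edge v a).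
Proof. by apply: edge_ext => //; exact: dactM. Qed.

(** A coarse inverse of the orbit map. As the quotient graph is finite, [rep] takes finitely many
    values, so replacing [x] by [G x] costs a bounded distance. *)
Lemma section_of_cproj : exists (rep : fvert C -> vert (ucover C))
  (G : vert (ucover C) -> free_group N), forall x, x = dact (G x) (rep (cproj x)).
Proof.
have /choice[rep repE] (z : fvert C) : exists x : vert (ucover C), cproj x = z.
  have [p pz] := cconn (z : vert C).
  have /andP[/andP[q /eqP qz] rq] :=
    @vert_wmulP _ C z z p [::] pz (introT andP (conj isT (eqxx z))) isT.
  by exists (exist (@is_cvert _ C) _ (introT andP (conj q rq))).
have /choice[G GE] x : exists u, x = dact u (rep (cproj x)).
  by apply: deck_transitive; rewrite repE.
by exists rep, G.
Qed.

Lemma bd_pi_exists X : exists xi, @bd_pi N C X xi.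
Proof.
have [xi rxi xiP] := @morphism_extension N (edge C) gr (cpi C) grK
  (@finite_words (fedge C)) cpi_reduced (@cpi_mul _ C) (@cpi_inj _ C) X.
exists xi; split => //; last first.
  by move=> u /xiP; under [X in cvg_word X _]eq_fun do rewrite -dact_base.
move=> k; have [u /xiP/(_ k)[n _ h]] := boundary_approx X.
rewrite -(h n (leqnn n)).
have /andP[/andP[+ _] _] := cpi_loop C (u n).
elim: k (cpi C (u n)) (cbase C) {h} => [|k IH] [|e s] z //= /andP[-> h].
exact: IH.
Qed.

Lemma bd_pi_unique X xi xi' : @bd_pi N C X xi -> @bd_pi N C X xi' -> xi = xi'.
Proof.
move=> [_ _ h] [_ _ h']; have [u uX] := boundary_approx X.
exact: cvg_word_unique (h u uX) (h' u uX).
Qed.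

Lemma cvg_dact K u (y : nat -> vert (ucover C)) X :
  (forall n, (size (val (y n)) <= K)%N) -> cvg_bd u X ->
  cvg_cover (fun n => dact (u n) (y n)) X.
Proof.
move=> yK uX; have [xi xiX] := bd_pi_exists X; exists xi => //.
have [_ _ /(_ u uX)] := xiX; under [X in cvg_word X]eq_fun do rewrite dact_base.
move=> uxi; apply: (cvg_word_wmul grK _ _ yK uxi) => n; first exact: cpi_reduced.
exact: vert_reduced.
Qed.

(** The way back from ends of the cover to ends of $F_N$. The map [G] is Lipschitz because the edges
    form finitely many orbits, and it is finite-to-one because [G x] and the vertex below [x]
    determine [x]; that vertex serves as the colour. *)
Lemma cover_extension (rep : fvert C -> vert (ucover C))
    (G : vert (ucover C) -> free_group N) :
  (forall x, x = dact (G x) (rep (cproj x))) ->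
  forall X xi, @bd_pi N C X xi -> exists Z, forall x : nat -> vert (ucover C),
    cvg_word (fun n => val (x n)) xi -> cvg_word (fun n => val (G (x n))) Z.
Proof.
move=> GP X xi [rxi pxi _].
pose F (s : seq (edge C)) := if insub s is Some x then val (G x) else [::].
have FE x : F (val x) = val (G x) by rewrite /F valK.
pose D := [set s | is_cvert (C := C) s].
have DE s : D s -> exists x : vert (ucover C), s = val x.
  by move=> rs; exists (exist _ s rs).
(* Two edges above the same [e] differ by a deck transformation, so the jump of [G] along them is
   the same element of $F_N$; it is read off any lift [a0]. *)
have /choice[K KP] (e : fedge C) : exists K, forall a, ceproj a = e -> exists g,
    G (ctgt a) = (G (corg a) * g)%g /\ (size (val g) <= K)%N.
  have [[a0 <-]|no] := EM (exists a, ceproj a = e); last first.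
    by exists 0%N => a ae; case: no; exists a.
  exists (size (val ((G (corg a0))^-1 * G (ctgt a0))%g)) => a ae.
  exists ((G (corg a0))^-1 * G (ctgt a0))%g; split => //.
  have eq_proj : cproj (corg a) = cproj (corg a0).
    by rewrite -(eqP (valP a)) -(eqP (valP a0)) -/(ceproj a) ae.
  have aE : a = dact_edge (G (corg a) * (G (corg a0))^-1)%g a0.
    apply: edge_ext; last by rewrite ae.
    rewrite -[RHS]/(dact (G (corg a) * (G (corg a0))^-1)%g (corg a0)).
    by rewrite dactM {2}(GP (corg a0)) -(dactM _^-1) mulVg dact1 -eq_proj -GP.
  apply: (@dact_free _ _ (rep (cproj (ctgt a)))); rewrite -GP.
  rewrite {1}aE ctgt_dact mulgA [RHS]dactM.
  have -> : cproj (ctgt a) = cproj (ctgt a0) by rewrite cproj_tgt ae -cproj_tgt.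
  by rewrite -GP.
have [Z ZP] : exists Z, forall w, (forall n, D (w n)) -> cvg_word w xi ->
    cvg_word (fun n => F (w n)) Z.
  apply: (@lipschitz_proper_extension _ _ (@linv N) D F (\max_(e : fedge C) K e)) => //.
  - exact: linvK.
  - by move=> s /DE[x ->]; rewrite FE; exact: reduced_letters.
  - move=> s e Dse.
    have /andP[pse rse] := Dse.
    have rs : reduced gr s by move: rse; rewrite /greduced /reduced -cats1 => /cat_sorted2[].
    have [ps oe] : epath (cbase C) s /\ org e = pend (cbase C) s.
      move: pse; rewrite -cats1; elim: s (cbase C) {Dse rse rs} => [|f s IH] z /=.
        by rewrite andbT => /eqP.
      by case/andP => -> /IH.
    pose x : vert (ucover C) := exist (@is_cvert _ C) s (introT andP (conj ps rs)).
    pose a : edge (ucover C) := exist (@is_cedge _ C) (x, e) (introT eqP oe).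
    have tE : val (ctgt a) = rcons s e.
      by rewrite /= /ctgt_word /= wmul_reduced_cat cats1.
    have [g [gE gK]] := KP e a erefl.
    exists (val g); split; first exact: reduced_letters.
      exact: leq_trans gK (leq_bigmax _).
    by rewrite -tE FE gE /= -[s]/(val x) FE.
  - move=> s k /andP[ps rs]; apply/andP; split; last exact: reduced_take.
    elim: k s (cbase C) ps {rs} => [|k IH] [|e s] z //= /andP[-> h].
    exact: IH.
  - apply: (@proper_finite_to_one _ _ _ D F
      (fun s => if insub s is Some x then cproj (x : vert (ucover C)) else cbase C)).
      exact: (@finite_words ('I_N * bool)%type).
    move=> s s' /DE[x ->] /DE[y ->]; rewrite !FE !valK => /val_inj Gxy xy.
    by rewrite (GP x) (GP y) Gxy xy.
  - move=> k; apply/andP; split => //; exact: reduced_mkseq.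
exists Z => x xxi.
have := ZP (fun n => val (x n)) (fun n => valP (x n)) xxi.
by under eq_fun do rewrite FE.
Qed.

(** Cancelling the bounded [y n] leaves an orbit tending to [xi], which [G] carries, up to the fixed
    right factor [c], to some end [Z]. A sequence of $F_N$ chosen to tend to [X] is carried to the
    same [Z], which identifies [Z] with [X]. *)
Lemma cvg_dact_inv K u (y : nat -> vert (ucover C)) X :
  (forall n, (size (val (y n)) <= K)%N) ->
  cvg_cover (fun n => dact (u n) (y n)) X -> cvg_bd u X.
Proof.
move=> yK [xi xiX uxi].
have {}uxi : cvg_word (fun n => val (dact (u n) (cbase_lift C))) xi.
  have := @cvg_word_wmul _ gr grK K _ (fun n => winv gr (val (y n))) _ _ _ _ uxi.
  rewrite (_ : (fun n => _) = (fun n => val (dact (u n) (cbase_lift C)))); last first.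
    by apply/funext => n; rewrite dact_base /= wmulKs ?cpi_reduced ?vert_reduced //; exact: grK.
  apply => n; rewrite ?vert_reduced ?reduced_winv ?vert_reduced //; first exact: grK.
  by rewrite size_rev size_map.
have [rep [G GP]] := section_of_cproj.
have [Z ZP] := cover_extension GP xiX.
pose c := G (cbase_lift C).
have GE v : G (dact v (cbase_lift C)) = (v * c)%g.
  apply: (@dact_free _ _ (rep (cproj (cbase_lift C)))).
  by rewrite dactM -GP -(cproj_dact v (cbase_lift C)) -GP.
have lim v : cvg_word (fun n => val (dact (v n) (cbase_lift C))) xi ->
    cvg_word (fun n => val (v n)) Z.
  move=> /ZP; under [X in cvg_word X _]eq_fun do rewrite GE.
  move=> vZ.
  have := @cvg_word_wmul _ (@linv N) (@linvK N) (size (val c^-1%g)) _ (fun=> val c^-1%g) _ _ _ _ vZ.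
  rewrite (_ : (fun n => _) = (fun n => val (v n))); last first.
    by apply/funext => n; rewrite -[RHS](congr1 val (mulgK c (v n))).
  by apply => // n; exact: reduced_letters.
have [v vX] := boundary_approx X.
have [_ _ /(_ v vX)/lim vZ] := xiX.
by rewrite /cvg_bd (cvg_word_unique vX vZ); exact: lim.
Qed.

Lemma cvg_cover_unique (x : nat -> vert (ucover C)) X Y : @cvg_cover N C x X -> cvg_cover x Y -> X = Y.
Proof.
move=> xX xY; have [rep [G GP]] := section_of_cproj.
have xE : x = (fun n => dact (G (x n)) (rep (cproj (x n)))).
  by apply/funext => n; rewrite -GP.
have yK n : (size (val (rep (cproj (x n)))) <= \max_z size (val (rep z)))%N.
  exact: (leq_bigmax (cproj (x n) : fvert C)).
move: xX xY; rewrite xE => /(cvg_dact_inv yK) xX /(cvg_dact_inv yK) xY.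
exact: cvg_bd_unique xX xY.
Qed.

Lemma bd_pi_inj X Y xi : @bd_pi N C X xi -> @bd_pi N C Y xi -> X = Y.
Proof.
move=> Xxi Yxi; have [u uX] := boundary_approx X.
have [_ _ /(_ u uX) uxi] := Xxi.
by apply: (@cvg_cover_unique (fun n => dact (u n) (cbase_lift C))); exists xi.
Qed.

End Charts.

(** Writing [x n] as [G (x n)] applied to a representative, [F (x n)] is [phi (G (x n))] applied to
    one of finitely many vertices. The same [Y] is the limit for group elements and for vertices,
    which is what later ties [Q] to the geometry of the cover. *)
Lemma cvg_twisted N (C : chart N) (phi : aut N) (F : vert (ucover C) -> vert (ucover C)) X :
  (forall u x, F (dact u x) = dact (phi u) (F x)) ->
  exists Y, (forall u, cvg_bd u X -> cvg_bd (fun n => phi (u n)) Y) /\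
    forall x, cvg_cover x X -> cvg_cover (fun n => F (x n)) Y.
Proof.
move=> FP; have [Y YP] := aut_extension phi X; exists Y; split => // x xX.
have [rep [G GP]] := section_of_cproj C.
have yK n : (size (val (rep (cproj (x n)))) <= \max_z size (val (rep z)))%N.
  exact: (leq_bigmax (cproj (x n) : fvert C)).
have FK n : (size (val (F (rep (cproj (x n))))) <= \max_z size (val (F (rep z))))%N.
  exact: (leq_bigmax (cproj (x n) : fvert C)).
have -> : (fun n => F (x n)) = (fun n => dact (phi (G (x n))) (F (rep (cproj (x n))))).
  by apply/funext => n; rewrite {1}(GP (x n)) FP.
apply: (cvg_dact FK); apply: YP; apply: (cvg_dact_inv yK).
by rewrite (_ : (fun n => _) = x) //; apply/funext => n; rewrite -GP.
Qed.

(** [F] need not be injective, but [phi] is invertible: the elements [phi (G (x n))] converge, and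
    the inverse automorphism recovers the limit of [G (x n)]. *)
Lemma cvg_twisted_inv N (C : chart N) (phi : aut N)
    (F : vert (ucover C) -> vert (ucover C)) Y :
  (forall u x, F (dact u x) = dact (phi u) (F x)) ->
  exists X, (forall u, cvg_bd u Y -> cvg_bd (fun n => aut_inv phi (u n)) X) /\
    forall x, cvg_cover (fun n => F (x n)) Y -> cvg_cover x X.
Proof.
move=> FP; have [X XP] := aut_extension (aut_inv phi) Y; exists X; split => // x xY.
have [rep [G GP]] := section_of_cproj C.
have yK n : (size (val (rep (cproj (x n)))) <= \max_z size (val (rep z)))%N.
  exact: (leq_bigmax (cproj (x n) : fvert C)).
have FK n : (size (val (F (rep (cproj (x n))))) <= \max_z size (val (F (rep z))))%N.
  exact: (leq_bigmax (cproj (x n) : fvert C)).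
have {}xY : cvg_bd (fun n => phi (G (x n))) Y.
  apply: (cvg_dact_inv FK); rewrite (_ : (fun n => _) = (fun n => F (x n))) //.
  by apply/funext => n; rewrite -FP -GP.
have -> : x = (fun n => dact (G (x n)) (rep (cproj (x n)))).
  by apply/funext => n; rewrite -GP.
apply: (cvg_dact yK); have := XP _ xY.
by under eq_fun do rewrite /= aut_funK.
Qed.

(** * Sides of an edge *)

Section Sides.
Variables (N : nat) (C : chart N).
Implicit Types (x y : vert (ucover C)) (a b e f : edge (ucover C)).
Implicit Types p q : seq (edge (ucover C)).
Notation gr := (@grev C).
Notation grK := (@grevK C).

(** The edge points away from the base vertex; the component beyond it then consists of the words
    that extend the word of its endpoint. *)
Definition up_edge e : bool := val (ctgt e) == rcons (val (corg e)) (ceproj e).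

Lemma edge_up_or_down e :
  up_edge e \/ val (corg e) = rcons (val (ctgt e)) (gr (ceproj e)).
Proof.
have := wmul_letter grK (ceproj e) (vert_reduced (corg e)).
by case=> [h|[s h1 h2]]; [left; apply/eqP|right; rewrite /= /ctgt_word h2 -h1].
Qed.

Lemma crevKo e : ctgt (crev e) = corg e.
Proof. by have := congr1 (@corg _ C) (crevK e). Qed.

Lemma up_crev e : up_edge (crev e) = ~~ up_edge e.
Proof.
have nn s (c d : edge C) : rcons (rcons s c) d != s :> seq (edge C).
  by apply/eqP => /(congr1 size); rewrite !size_rcons => /eqP; rewrite -addn2 -{2}[size s]addn0 eqn_add2l.
have -> : up_edge (crev e) = (val (corg e) == rcons (val (ctgt e)) (gr (ceproj e))).
  by rewrite /up_edge crevKo.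
case: (edge_up_or_down e) => [u|d].
  by rewrite u (eqP u) eq_sym (negPf (nn _ _ _)).
by rewrite /up_edge d eqxx eq_sym (negPf (nn _ _ _)).
Qed.

Lemma up_edge_inj e f : up_edge e -> up_edge f -> ctgt e = ctgt f -> e = f.
Proof.
move=> /eqP ue /eqP uf /(congr1 val); rewrite ue uf => /rcons_inj[eo ec].
by apply: edge_ext => //; exact: val_inj.
Qed.

(* Removing the edge [e] disconnects the universal cover; [side e y] says that
   [y] lies in the component of the endpoint of [e]. *)
Definition side e y : bool :=
  if up_edge e then prefix (val (ctgt e)) (val y)
  else ~~ prefix (val (corg e)) (val y).

Lemma side_crev e y : side (crev e) y = ~~ side e y.
Proof. by rewrite /side up_crev crevKo; case: (up_edge e) => //=; rewrite negbK. Qed.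

Lemma prefix_rconsE (T : eqType) (w s : seq T) c :
  prefix w (rcons s c) = (w == rcons s c) || prefix w s.
Proof.
apply/idP/orP => [|[/eqP ->|/prefixP[t ->]]]; last 1 first.
- by rewrite -cats1 -catA prefix_prefix.
- case/prefixP=> t; case/lastP: t => [|t d]; first by rewrite cats0 => ->; left.
  by rewrite -rcons_cat => /rcons_inj[-> _]; right; exact: prefix_prefix.
- exact: prefix_refl.
Qed.

Lemma prefix_enter (w : seq (edge C)) f :
  ~~ prefix w (val (corg f)) -> prefix w (val (ctgt f)) ->
  up_edge f /\ val (ctgt f) = w.
Proof.
case: (edge_up_or_down f) => [u|->]; last first.
  by rewrite prefix_rconsE negb_or => /andP[_ /negPf->].
by rewrite u (eqP u) prefix_rconsE => /negPf-> /orP[/eqP->|].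
Qed.

Lemma side_enter e f : ~~ side e (corg f) -> side e (ctgt f) -> f = e.
Proof.
rewrite /side; case: ifP => [ue no|/negbT de].
  case/(prefix_enter no) => uf tf; apply: up_edge_inj => //; exact: val_inj.
(* Here [e] points towards the base vertex: [f] leaves the subtree of words extending [corg e], so
   [crev f] enters it, necessarily through [crev e]. *)
rewrite negbK => o no.
have [] := @prefix_enter (val (corg e)) (crev f); rewrite ?crevKo // => uf tf.
apply: (can_inj (@crevK _ C)); apply: up_edge_inj; rewrite ?up_crev ?crevKo //.
  by rewrite -up_crev.
exact: val_inj.
Qed.

Lemma side_org e : ~~ side e (corg e).
Proof.
rewrite /side; case: ifP => [/eqP ->|]; last by rewrite prefix_refl.
by apply/negP => /size_prefix; rewrite size_rcons ltnn.
Qed.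

Lemma side_tgt e : side e (ctgt e).
Proof. by have := side_org (crev e); rewrite side_crev negbK. Qed.

Lemma side_edge e f : f != e -> f != crev e -> side e (ctgt f) = side e (corg f).
Proof.
move=> /eqP fe /eqP fce; case: (boolP (side e (corg f))) => so; last first.
  by apply/negbTE/negP => st; apply: fe; exact: side_enter.
apply/negPn/negP => st; apply: fce; apply: side_enter; rewrite side_crev ?negbK //.
Qed.

Lemma path_cross e x p : epath x p -> ~~ side e x -> side e (pend x p) -> e \in p.
Proof.
elim: p x => [|f p IH] x /=; first by move=> _ /negPf sx; rewrite /pend /= sx.
case/andP=> /eqP <- pp sx; rewrite inE.
case: (boolP (side e (tgt f))) => st.
  by have -> := side_enter sx st; rewrite eqxx.
by move=> h; rewrite (IH _ pp st) ?orbT.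
Qed.

Lemma side_path e x p : epath x p -> e \notin p -> crev e \notin p ->
  side e (pend x p) = side e x.
Proof.
elim: p x => [|f p IH] x //=; case/andP=> /eqP <- pp.
rewrite !inE !negb_or => /andP[ef ep] /andP[cf cp].
rewrite /pend /= -/(pend _ _) IH // -/(tgt f).
by rewrite [LHS]side_edge 1?eq_sym.
Qed.

Lemma epath_cat (G : graph) (x : vert G) (p1 p2 : seq (edge G)) :
  epath x (p1 ++ p2) = epath x p1 && epath (pend x p1) p2.
Proof. by elim: p1 x => //= e p IH x; rewrite IH andbA. Qed.

Lemma pend_cat (G : graph) (x : vert G) (p1 p2 : seq (edge G)) :
  pend x (p1 ++ p2) = pend (pend x p1) p2.
Proof. by rewrite /pend map_cat last_cat. Qed.

Lemma greduced_proj x p : epath x p -> greduced p = reduced gr (map (@ceproj _ C) p).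
Proof.
elim: p x => [|a [|b p] IH] x //= /andP[/eqP ox pp].
have := IH _ pp; rewrite /greduced /Defs.reduced /= => ->; congr (_ && _).
case/andP: pp => /eqP ob _; congr negb; apply/eqP/eqP => [-> //|e].
exact: edge_ext.
Qed.

Lemma val_pend x p : epath x p ->
  val (pend x p) = wmul gr (val x) (wred gr (map (@ceproj _ C) p)).
Proof.
elim: p x => [|a p IH] x /=; first by rewrite wmuls0 ?vert_reduced.
case/andP=> /eqP <- /IH; rewrite /pend /= => ->.
by rewrite /ctgt_word wmulA //; [exact: grK|exact: reduced_wmul].
Qed.

(** The cover is a tree: the projection of [p] is a reduced word whose product with the word of [x]
    is again the word of [x], and cancelling [x] leaves the empty word. *)
Lemma reduced_closed_path x p : epath x p -> greduced p -> pend x p = x -> p = [::].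
Proof.
move=> pp rp /(congr1 val); rewrite val_pend // => e.
move: rp; rewrite (greduced_proj pp) => rp.
move: e; rewrite /wred (wmuls0 rp) -[RHS](wmuls0 (vert_reduced x)).
by move/(wmul_injr grK rp) => /(_ isT); case: p {rp pp}.
Qed.

Lemma path_proj_inj x p q : epath x p -> epath x q ->
  map (@ceproj _ C) p = map (@ceproj _ C) q -> p = q.
Proof.
elim: p q x => [|a p IH] [|b q] x //= /andP[/eqP oa pp] /andP[/eqP ob pq] [ab pq'].
have eab : a = b by apply: edge_ext => //; exact: etrans oa (esym ob).
by rewrite eab in pp *; congr cons; exact: (IH _ _ pp pq pq').
Qed.

Lemma reduced_cat (G : graph) (p q : seq (edge G)) :
  greduced (p ++ q) -> greduced p /\ greduced q.
Proof. by rewrite /greduced /Defs.reduced => /cat_sorted2[]. Qed.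

(** A second passage through [e] would close up a non-empty reduced path. A passage through [crev e]
    would close up the part in between, which is then empty, so that [e] and [crev e] would be
    adjacent. *)
Lemma reduced_path_no_return e x p : epath x (e :: p) -> greduced (e :: p) ->
  e \notin p /\ crev e \notin p.
Proof.
rewrite [epath _ _]/= => /andP[/eqP oe pp] rp.
split; apply/negP => ep; case/splitPr: ep pp rp => p1 p2 pp rp.
- have ep : epath (org e) (e :: p1) by move: pp; rewrite epath_cat /= eqxx => /andP[].
  have /reduced_cat[r1 _] : greduced ((e :: p1) ++ e :: p2) by [].
  have := reduced_closed_path ep r1; suff -> : pend (org e) (e :: p1) = org e by move/(_ erefl).
  by move: pp; rewrite epath_cat => /andP[_ /= /andP[/eqP]].
move: pp; rewrite epath_cat => /andP[pp1 /= /andP[/eqP o2 _]].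
have p1E : p1 = [::].
  apply: (reduced_closed_path pp1); last by rewrite -o2.
  have /reduced_cat[] : greduced ((e :: p1) ++ crev e :: p2) by [].
  by move=> /path_sorted.
by move: rp; rewrite p1E /greduced /Defs.reduced /= eqxx.
Qed.

Lemma side_end e x p : epath x (e :: p) -> greduced (e :: p) -> side e (pend x (e :: p)).
Proof.
move=> pp rp; have [h1 h2] := reduced_path_no_return pp rp.
case/andP: pp => _ pp.
by rewrite -[pend x _]/(pend (tgt e) p) (side_path pp) //; exact: side_tgt.
Qed.

Lemma greduced_rev (G : graph) (p : seq (edge G)) : greduced p -> greduced (grpath p).
Proof. exact/reduced_winv/grevK. Qed.

Lemma reduced_path_cross e x p : epath x p -> greduced p -> e \in p ->
  ~~ side e x /\ side e (pend x p).
Proof.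
move=> pp rp ep; case/splitPr: ep pp rp => p1 p2 pp rp.
have := pp; rewrite epath_cat => /andP[pp1 pp2].
have [_ r2] := reduced_cat rp.
rewrite pend_cat side_end //; split=> //.
(* The initial segment read backwards is a reduced path starting with [crev e]; it ends at [x], on
   the far side of [crev e], that is, the near side of [e]. *)
have : path_from_to x (tgt e) (p1 ++ [:: e]).
  move: pp2 => /= /andP[oe _].
  by rewrite /path_from_to epath_cat pp1 pend_cat /= oe /= eqxx.
move/path_from_to_rev => /andP[pr /eqP er].
have : greduced (p1 ++ [:: e]).
  by have /reduced_cat[] : greduced ((p1 ++ [:: e]) ++ p2); rewrite -?catA.
move/greduced_rev; move: pr er.
rewrite /grpath cats1 /winv map_rcons rev_rcons => pr er rr.
by have := side_end pr rr; rewrite er side_crev.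
Qed.

(** The side of [e] is decided by a prefix of fixed length, and that prefix is eventually the one of
    the end, whatever the sequence. *)
Lemma side_limit e X : exists c : bool, forall x : nat -> vert (ucover C), cvg_cover x X ->
  \forall n \near \oo, side e (x n) = c.
Proof.
have [xi xiX] := bd_pi_exists C X.
have pre (w : seq (edge C)) : exists c : bool, forall x : nat -> vert (ucover C), cvg_cover x X ->
    \forall n \near \oo, prefix w (val (x n)) = c.
  exists (mkseq xi (size w) == w) => x [xi' xi'X] /(_ (size w)).
  rewrite (bd_pi_unique xi'X xiX); apply: filterS => n xn.
  by rewrite prefixE xn.
rewrite /side; case: (up_edge e); first exact: pre.
have [c cP] := pre (val (corg e)); exists (~~ c) => x /cP.
by apply: filterS => n ->.
Qed.

End Sides.

Lemma consecutive_edges_path (G : graph) (h : nat -> edge G) n :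
  (forall j, org (h j.+1) = tgt (h j)) -> (forall j, h j.+1 <> grev (h j)) ->
  [/\ epath (org (h 0%N)) (mkseq h n), pend (org (h 0%N)) (mkseq h n) = org (h n) &
      greduced (mkseq h n)].
Proof.
move=> ho hr; split; last exact: reduced_mkseq.
  elim: n => // n; rewrite mkseqS -cats1 epath_cat => -> /=.
  suff -> : pend (org (h 0%N)) (mkseq h n) = org (h n) by rewrite eqxx.
  by case: n => // n; rewrite /pend mkseqS map_rcons last_rcons ho.
by case: n => // n; rewrite /pend mkseqS map_rcons last_rcons ho.
Qed.

(** * Lines and the edges that they cross *)

Section Lines.
Variables (N : nat) (C : chart N).
Implicit Types (e : edge (ucover C)) (X Y : boundary N).
Notation gr := (@grev C).

Definition end_side e X (c : bool) : Prop :=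
  forall x : nat -> vert (ucover C), cvg_cover x X ->
    \forall n \near \oo, side e (x n) = c.

(** Sides stabilise along convergent sequences, so infinitely many indices decide; this lets
    information that recurs only along a subsequence be used. *)
Lemma end_side_frequently e X c (x : nat -> vert (ucover C)) : cvg_cover x X ->
  (forall m, exists2 n, (m <= n)%N & side e (x n) = c) -> end_side e X c.
Proof.
move=> xX freq y yX; have [d dP] := side_limit e X.
suff <- : d = c by exact: dP.
have [m _ h] := dP x xX; have [n mn <-] := freq m.
by rewrite -(h n mn).
Qed.

Lemma boundary_ray X xi : @bd_pi N C X xi -> exists E : nat -> edge (ucover C),
  [/\ forall n, val (corg (E n)) = mkseq xi n, forall n, ceproj (E n) = xi n &
      forall n, ctgt (E n) = corg (E n.+1)].
Proof.
move=> [rxi pxi _].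
have V n : is_cvert (C := C) (mkseq xi n).
  by rewrite /is_cvert pxi /=; exact: reduced_mkseq.
pose W n : cvert C := exist (@is_cvert _ C) _ (V n).
have P n : is_cedge (W n, xi n).
  have := pxi n.+1; rewrite mkseqS -cats1 epath_cat /= => /andP[_].
  by rewrite andbT.
exists (fun n => exist (@is_cedge _ C) _ (P n)); split=> // n.
apply: val_inj; rewrite /= /ctgt_word /= wmul_reduced_cat cats1 -mkseqS //.
exact: reduced_mkseq.
Qed.

Lemma line_realisation X Y : X <> Y ->
  exists g : int -> edge (ucover C), realisation (X, Y) g.
Proof.
move=> XY; have [xi xiX] := bd_pi_exists C X; have [eta etaY] := bd_pi_exists C Y.
have [m xm mmin] : exists2 m, xi m != eta m & forall j, (j < m)%N -> xi j = eta j.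
  have ex : exists m, xi m != eta m.
    apply: contrapT => no; apply: XY; apply: (bd_pi_inj (xi := xi)) => //.
    rewrite (_ : xi = eta) //; apply/funext => m; apply/eqP/negPn/negP => h.
    by apply: no; exists m.
  case: (ex_minnP ex) => m xm mmin; exists m => // j jm.
  by apply/eqP/negPn/negP => /mmin; rewrite leqNgt jm.
have [EX [EXo EXp EXt]] := boundary_ray xiX.
have [EY [EYo EYp EYt]] := boundary_ray etaY.
have [rxi _ _] := xiX; have [reta _ _] := etaY.
have oXY : corg (EX m) = corg (EY m).
  apply: val_inj; rewrite EXo EYo; apply/eq_in_map => j.
  by rewrite mem_iota add0n => /mmin.
(* The two rays part at index [m]. The line descends the ray to [X] backwards and ascends the ray to
   [Y]; index -1, which is [Negz 0], carries the reverse of [EX m], ending where [EY m] starts. *)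
pose g (i : int) := match i with Posz n => EY (m + n)%N | Negz n => crev (EX (m + n)%N) end.
have gS n : (Posz n + 1 = Posz n.+1)%R by rewrite -PoszD addn1.
have gN n : (Negz n.+1 + 1 = Negz n)%R.
  by rewrite !NegzE -[n.+2]addn1 PoszD opprD addrNK.
have g0 : (Negz 0 + 1 = 0)%R by [].
have cR (a : edge (ucover C)) : ceproj (crev a) = gr (ceproj a) by [].
exists g; split.
- case=> [n|[|n]]; rewrite ?gS ?gN ?g0 /= ?addnS ?addn0.
  + exact/esym/EYt.
  + by rewrite -[RHS]/(ctgt (crev (EX m))) crevKo -oXY.
  + by rewrite -[RHS]/(ctgt (crev (EX _))) crevKo -EXt.
- case=> [n|[|n]]; rewrite ?gS ?gN ?g0 /= ?addnS ?addn0 => /(congr1 (@ceproj _ C)) /=.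
  + by rewrite cR !EYp; exact: reta.
  + by rewrite crevK EXp EYp => h; case/eqP: xm.
  + by rewrite crevK cR !EXp => h; apply: (rxi (m + n)%N); rewrite -h.
- exists xi => //; rewrite (_ : (fun n => _) = (fun n => mkseq xi (m + n)%N)).
    move=> k; have [n _ h] := cvg_word_mkseq xi k; exists n => //= i ni; apply: h.
    by rewrite /= (leq_trans ni) ?leq_addl.
  apply/funext => -[|n]; first by rewrite oppr0 /= addn0 -EXo oXY.
  by rewrite -NegzE /g addnS -EXo -EXt.
- exists eta => //; rewrite (_ : (fun n => _) = (fun n => mkseq eta (m + n)%N)).
    move=> k; have [n _ h] := cvg_word_mkseq eta k; exists n => //= i ni; apply: h.
    by rewrite /= (leq_trans ni) ?leq_addl.
  by apply/funext => n; rewrite -EYo.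
Qed.

Lemma realisation_path (g : int -> edge (ucover C)) X Y M : realisation (X, Y) g ->
  let h j := g (- M%:Z + j%:Z) in
  [/\ epath (org (g (- M%:Z))) (mkseq h (M + M)),
    pend (org (g (- M%:Z))) (mkseq h (M + M)) = org (g M%:Z) & greduced (mkseq h (M + M))].
Proof.
move=> [go gr' _ _] h.
have hS j : - M%:Z + j.+1%:Z = - M%:Z + j%:Z + 1 by rewrite -addn1 PoszD addrA.
have [] := @consecutive_edges_path _ h (M + M).
- by move=> j; rewrite /h hS go.
- by move=> j; rewrite /h hS; exact: gr'.
by rewrite /h addr0 PoszD addKr.
Qed.

Lemma cyl_edgeP e X Y : X <> Y ->
  cyl_path [:: e] (X, Y) <-> end_side e X false /\ end_side e Y true.
Proof.
move=> XY; split=> [[_ [g [gP [k]]]]|[eX eY]].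
- rewrite /mkseq /= addr0 => -[ek].
  have sides M : (`|k| < M)%N -> ~~ side e (org (g (- M%:Z))) /\ side e (org (g M%:Z)).
    move=> kM; have [pp <- rp] := realisation_path M gP.
    apply: reduced_path_cross => //; apply/mapP.
    have kM0 : 0 <= k + M%:Z.
      by rewrite -lerBlDr sub0r lerNl (le_trans (ler_norm _)) // normrN -abszE lez_nat ltnW.
    have kM2 : k + M%:Z < (M + M)%N%:Z.
      by rewrite PoszD ltrD2r (le_lt_trans (ler_norm _)) // -abszE ltz_nat.
    exists (absz (k + M%:Z)); last by rewrite gez0_abs // addrC addrK.
    by rewrite mem_iota -ltz_nat gez0_abs.
  have [_ _ gX gY] := gP.
  split; [apply: (end_side_frequently gX)|apply: (end_side_frequently gY)] => m;
    exists (m + `|k|.+1)%N; rewrite ?leq_addr //.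
    by apply/negbTE; have [] := sides (m + `|k|.+1)%N _; rewrite // leq_addl.
  by have [] := sides (m + `|k|.+1)%N _; rewrite // leq_addl.
have [g gP] := line_realisation XY; split=> //; exists g; split=> //.
have [_ _ gX gY] := gP.
have [m _ hX] := eX _ gX; have [n _ hY] := eY _ gY; pose M := maxn m n.
have [pp pe rp] := realisation_path M gP.
have : e \in mkseq (fun j : nat => g (- M%:Z + j%:Z)) (M + M).
  apply: (path_cross pp); first by rewrite hX // /M /= leq_maxl.
  by rewrite pe hY // /M /= leq_maxr.
by case/mapP => j _ ->; exists (- M%:Z + j%:Z); rewrite /mkseq /= addr0.
Qed.

End Lines.

(** * Lifts *)

Section Lifts.
Variables (N : nat) (C : chart N) (f : graph_map C C).
Implicit Types (x y : vert (ucover C)) (a e : edge (ucover C)) (p : seq (edge (ucover C))).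

Lemma ucover_induction (P : vert (ucover C) -> Prop) :
  P (cbase_lift C) -> (forall a, P (corg a) -> P (ctgt a)) -> forall x, P x.
Proof.
move=> P0 PS [s sP]; elim/last_ind: s sP => [|s c IH] sP.
  by rewrite (_ : exist _ _ _ = cbase_lift C) //; apply: val_inj.
have [psc rsc] := andP sP.
have rs : reduced (@grev C) s by move: rsc; rewrite /greduced /reduced -cats1 => /cat_sorted2[].
have [ps /andP[oc _]] : epath (cbase C) s /\ epath (pend (cbase C) s) [:: c].
  by apply/andP; rewrite -epath_cat cats1.
pose x : vert (ucover C) := exist (@is_cvert _ C) s (introT andP (conj ps rs)).
pose a : edge (ucover C) := exist (@is_cedge _ C) (x, c) oc.
rewrite (_ : exist _ _ _ = ctgt a); first exact: (PS a (IH _)).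
by apply: val_inj; rewrite /= /ctgt_word /= wmul_reduced_cat cats1.
Qed.

Lemma epath_dact u x p : epath (dact u x) (map (dact_edge u) p) = epath x p.
Proof.
elim: p x => //= a p IH x; congr (_ && _); last first.
  by rewrite -[X in epath X]/(ctgt (dact_edge u a)) ctgt_dact IH.
apply/eqP/eqP => [h|<- //].
have : dact u (corg a) = dact u x := h.
by move/(congr1 (dact u^-1%g)); rewrite -!dactM mulVg !dact1.
Qed.

Lemma pend_dact u x p : pend (dact u x) (map (dact_edge u) p) = dact u (pend x p).
Proof. by elim: p x => // a p IH x; have := IH (ctgt a); rewrite -ctgt_dact. Qed.

Lemma map_ceproj_dact u p : map (@ceproj _ C) (map (dact_edge u) p) = map (@ceproj _ C) p.
Proof. by rewrite -map_comp. Qed.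

(** The two images of the base vertex have the same projection, which gives [d]. Uniqueness of path
    lifting spreads the equality along edges, and freeness of the deck action turns it into the
    relation between [psi] and [phi]. *)
Lemma associated_lifts_differ_by_deck phi psi ft gt :
  associated_lift f phi ft -> associated_lift f psi gt ->
  exists d, [/\ forall x, gt x = dact d (ft x),
    forall a, emap gt a = map (dact_edge d) (emap ft a) &
    forall u, psi u = (d * phi u * d^-1)%g].
Proof.
move=> [fv fe fu _] [gv ge gu _].
have [d dP] : exists d, gt (cbase_lift C) = dact d (ft (cbase_lift C)).
  by apply: deck_transitive; rewrite fv gv.
have edges a : gt (corg a) = dact d (ft (corg a)) ->
    emap gt a = map (dact_edge d) (emap ft a).
  have /andP[pf _] := emap_path ft a; have /andP[pg _] := emap_path gt a.
  move=> h; apply: (path_proj_inj (x := gt (corg a))) => //; first by rewrite h epath_dact.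
  by rewrite map_ceproj_dact fe ge.
have verts x : gt x = dact d (ft x).
  elim/ucover_induction: x => // a IH.
  have /andP[_ /eqP <-] := emap_path ft a; have /andP[_ /eqP <-] := emap_path gt a.
  by rewrite edges // IH pend_dact.
exists d; split=> // [a|u]; first exact: edges.
suff : (psi u * d)%g = (d * phi u)%g by move=> <-; rewrite mulgK.
apply: (@dact_free _ _ _ _ (ft (cbase_lift C))).
by rewrite !dactM -verts -gu verts fu.
Qed.

End Lifts.

Lemma pmap_edge_cons (G G' : graph) (f : graph_map G G') a p :
  pmap_edge f (a :: p) = emap f a ++ pmap_edge f p.
Proof. by []. Qed.

Section MapsOnPaths.
Variables (G : graph) (ft : graph_map G G).

Lemma path_pmap x y p : path_from_to x y p -> path_from_to (ft x) (ft y) (pmap_edge ft p).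
Proof.
elim: p x => [|a p IH] x; first by rewrite /path_from_to /pend /= => /eqP ->.
rewrite /path_from_to /= => /andP[/andP[/eqP <- pp] pe].
by apply: (path_from_to_cat (emap_path ft a)); apply: IH; rewrite /path_from_to pp.
Qed.

Lemma path_iter_pmap x y p n : path_from_to x y p ->
  path_from_to (iter n ft x) (iter n ft y) (iter n (pmap_edge ft) p).
Proof. by move=> pp; elim: n => //= n; exact: path_pmap. Qed.

End MapsOnPaths.

Section IteratedEdges.
Variables (N : nat) (C : chart N) (f : graph_map C C) (phi : aut N).
Variable ft : graph_map (ucover C) (ucover C).
Hypothesis hft : associated_lift f phi ft.
Hypothesis htt : is_train_track f.

Lemma map_ceproj_pmap p :
  map (@ceproj _ C) (pmap_edge ft p) = pmap_edge f (map (@ceproj _ C) p).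
Proof.
have [_ fe _ _] := hft.
by elim: p => // a p IH; rewrite map_cons !pmap_edge_cons map_cat fe IH.
Qed.

Lemma pmap_dact u p :
  pmap_edge ft (map (dact_edge u) p) = map (dact_edge (phi u)) (pmap_edge ft p).
Proof.
have [_ _ _ fu] := hft.
by elim: p => // a p IH; rewrite map_cons !pmap_edge_cons map_cat fu IH.
Qed.

Definition iterated_edge n u (o : edge (ucover C)) : seq (edge (ucover C)) :=
  map (dact_edge u) (iter n (pmap_edge ft) [:: o]).

Lemma pmap_iterated_edge n u o :
  pmap_edge ft (iterated_edge n u o) = iterated_edge n.+1 (phi u) o.
Proof. exact: pmap_dact. Qed.

Lemma iterated_edge_path n u o :
  [/\ epath (dact u (iter n ft (org o))) (iterated_edge n u o),
    pend (dact u (iter n ft (org o))) (iterated_edge n u o) =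
      dact u (iter n ft (tgt o)) & greduced (iterated_edge n u o)].
Proof.
have /(path_iter_pmap ft n) /andP[pp /eqP pe] : path_from_to (org o) (tgt o) [:: o].
  by rewrite /path_from_to /= /pend /= !eqxx.
have pp' : epath (dact u (iter n ft (org o))) (iterated_edge n u o) by rewrite epath_dact.
split; rewrite ?pend_dact ?pe // (greduced_proj pp') map_ceproj_dact.
have -> : map (@ceproj _ C) (iter n (pmap_edge ft) [:: o]) =
    iter n (pmap_edge f) [:: ceproj o].
  by elim: n {pp pe pp'} => //= n IH; rewrite map_ceproj_pmap IH.
(* The train-track property speaks of positive [n]; for [n = 0] the path is a single edge. *)
by case: n {pp pe pp'} => // n; have [] := @htt n.+1 (ceproj o) isT.
Qed.

Lemma dact_edge_inj_edge u v (a : edge (ucover C)) :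
  dact_edge u a = dact_edge v a -> u = v.
Proof. by move/(congr1 (@corg _ C)) => /dact_free. Qed.

Lemma emap_lift_path e : exists x, epath x (emap ft e).
Proof. by exists (ft (org e)); have /andP[] := emap_path ft e. Qed.

Lemma in_decomposition e e' p s : decomposition ft e (e', p, s) <-> emap ft e' = p ++ e :: s.
Proof.
split=> [[_ _ //]|h]; split=> //=; rewrite -h; last exact: emap_reduced.
exact: emap_lift_path.
Qed.

Lemma edge_deck (a b : edge (ucover C)) : ceproj a = ceproj b -> exists u, a = dact_edge u b.
Proof.
move=> ab; have [u uP] : exists u, corg a = dact u (corg b).
  apply: deck_transitive.
  by rewrite -(eqP (valP a)) -(eqP (valP b)) -!/(ceproj _) ab.
by exists u; apply: edge_ext.
Qed.

(** A triple is determined by the projection of its edge and the position of [e] in the image: two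
    triples sharing these data differ by a deck transformation [u] such that [phi u] fixes [e], and
    the action is free. *)
Lemma finite_decomposition e : finite_set (decomposition ft e).
Proof.
pose K := \max_(c : fedge C) size (emap f c).
apply: (@finite_set_inj_on _ _ _ ([set: fedge C] `*` `I_K.+1)
  (fun t => (ceproj t.1.1 : fedge C, size t.1.2))); last 2 first.
- move=> _ [[[e' p] s] /in_decomposition h <-]; split=> //=.
  have [_ fe _ _] := hft.
  have := congr1 size (fe e'); rewrite size_map h size_cat => hs.
  rewrite ltnS; apply: leq_trans (leq_addr (size (e :: s)) _) _.
  by rewrite hs (leq_bigmax (ceproj e' : fedge C)).
- exact: finite_setX finite_finset (finite_II _).
move=> [[e1 p1] s1] [[e2 p2] s2] /[!inE] /in_decomposition h1 /in_decomposition h2 /=.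
case=> /edge_deck[u e12] p12.
have [_ _ _ fu] := hft.
have h12 : map (dact_edge (phi u)) (p2 ++ e :: s2) = p1 ++ e :: s1.
  by rewrite -h1 -h2 e12 fu.
have ue : dact_edge (phi u) e = e.
  have := congr1 (fun q => nth e q (size p1)) h12.
  rewrite nth_cat ltnn subnn /= (nth_map e) ?size_cat /= ?p12 ?addnS ?ltnS ?leq_addr //.
  by rewrite nth_cat ltnn subnn.
have u1 : u = 1%g.
  apply: (can_inj (aut_funK phi)); apply: (@dact_edge_inj_edge _ _ e).
  by rewrite ue aut_one dact_edge1.
rewrite u1 dact_edge1 in e12; move: h2; rewrite -e12 h1 => /eqP.
by rewrite eqseq_cat // => /andP[/eqP -> /eqP [->]]; rewrite e12.
Qed.

End IteratedEdges.

(** * Separation in the observers' topology *)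

Section MetricTreeSides.
Variables (R : realType) (T : metricType R).
Implicit Types (p q x y z M : T) (r : R -> T) (K : T -> Prop).

Lemma open_hat_subbase (U : set (hat T)) : hat_subbase U -> open U.
Proof.
move=> hU; exists [set U]; last by rewrite bigcup_set1.
by move=> _ ->; exact: (finI_from1 id hU).
Qed.

Lemma open_direction (U : set (obs T)) : directions U -> open U.
Proof.
move=> hU; exists [set U]; last by rewrite bigcup_set1.
by move=> _ ->; exact: (finI_from1 id hU).
Qed.

Lemma between_sym x y z : between x y z -> between z y x.
Proof. by rewrite /between (metric_sym z x) (metric_sym z y) (metric_sym y x) addrC. Qed.

(** The four-point condition for [x], [M], [y], [z]: one of the two sums bounding the left side must
    be attained, and this is an equality in a triangle inequality. *)
Lemma between_branch x M y z : zero_hyperbolic T ->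
  between x M y -> between x M z \/ between y M z.
Proof.
rewrite /between => hyp xMy; have := hyp x M y z.
have t1 := metric_triangle x M z; have t2 := metric_triangle y M z.
rewrite (metric_sym M y) in xMy * => h.
case: (lerP (mdist x M + mdist y z) (mdist x z + mdist y M)) => c; [left|right];
  move: h; rewrite /Num.max; case: ifP => _; lra.
Qed.

(* [K] is a union of components of the complement of [M]. *)
Definition side_invariant M K : Prop := forall p q, ~ between p M q -> K p -> K q.

Lemma side_invariantN M K : side_invariant M K -> side_invariant M (fun p => ~ K p).
Proof. by move=> KP p q npq np /(KP q p) Kp; apply: np; apply: Kp => /between_sym. Qed.

Lemma side_invariant_between x M : zero_hyperbolic T ->
  side_invariant M (fun p => ~ between x M p).
Proof.
move=> hyp p q npq nxp xMq; have [//|qMp] := between_branch p hyp xMq.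
exact/npq/between_sym.
Qed.

(** The extension of [K] to ends. A ray past the distance [mdist (r 0) M] can no longer meet [M], so
    from there on it stays on one side. *)
Definition half M K : set (hat T) := [set Z | match Z with
  | inl p => p <> M /\ K p
  | inr A => exists2 r, sval A r & exists2 u, mdist (r 0) M < u & K (r u)
  end].

Lemma ball_side M p q : mdist p q < mdist p M -> ~ between p M q.
Proof. by rewrite /between => h e; have := mdist_ge0 M q; lra. Qed.

Lemma ray_dist r t : is_ray r -> 0 <= t -> mdist (r 0) (r t) = t.
Proof. by move=> rr t0; rewrite rr // sub0r normrN ger0_norm. Qed.

Lemma ray_side M r u v : is_ray r -> mdist (r 0) M < u -> mdist (r 0) M < v ->
  ~ between (r u) M (r v).
Proof.
move=> rr uM vM; have m0 := mdist_ge0 (r 0) M.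
have u0 : 0 <= u by lra. have v0 : 0 <= v by lra.
have := metric_triangle (r 0) M (r u); have := metric_triangle (r 0) M (r v).
rewrite /between rr // !ray_dist // (metric_sym M (r u)).
by case: (lerP v u) => vu; lra.
Qed.

Lemma end_ray (A : {A : set (R -> T) | is_end A}) r : sval A r -> is_ray r.
Proof. by case: A => A [r0 rr0 AE] /=; rewrite AE => -[]. Qed.

Lemma end_asymptotic (A : {A : set (R -> T) | is_end A}) r r' :
  sval A r -> sval A r' -> exists B, forall t, 0 <= t -> mdist (r t) (r' t) <= B.
Proof.
case: A => A [r0 rr0 AE] /=; rewrite AE => -[_ [B hB]] [_ [B' hB']].
exists (B + B') => t t0; have := metric_triangle (r t) (r0 t) (r' t).
by rewrite (metric_sym (r t) (r0 t)); have := hB t t0; have := hB' t t0; lra.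
Qed.

Lemma end_nonempty (A : {A : set (R -> T) | is_end A}) : exists r, sval A r.
Proof.
case: A => A [r0 rr0 AE] /=; rewrite AE; exists r0; split=> //.
by exists 0 => t t0; rewrite rr0 // subrr normr0.
Qed.

(** Around a point the ball reaching up to [M] stays on one side; around an end the shadow cast from
    a point of a ray beyond [M] does. *)
Lemma open_half M K : side_invariant M K -> open (half M K).
Proof.
move=> KP; rewrite openE => Z hZ; rewrite /interior nbhsE.
case: Z hZ => [p [pM Kp]|A [r Ar [u uM Kru]]].
  exists (inl @` ball p (mdist p M)).
    split; first by apply: open_hat_subbase; left; exists p, (mdist p M).
    by exists p => //; rewrite ballEmdist /= mdistxx mdist_gt0; exact/eqP.
  move=> _ [q + <-]; rewrite ballEmdist /= => pq; split.
    by move=> qM; rewrite qM ltxx in pq.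
  exact: KP (ball_side pq) Kp.
have rr := end_ray Ar; have m0 := mdist_ge0 (r 0) M.
have u0 : 0 <= u by lra.
exists (shadow r u).
  split; first by apply: open_hat_subbase; right; exists r, u.
  by exists (u + 1); [lra|exists r].
case=> [p [s us rsp]|B [s us [r' Br' [r'0 r's]]]].
  have s0 : 0 <= s by lra.
  have Krs : K (r s) by apply: (KP (r u)) => //; apply: ray_side => //; lra.
  move: (rsp); rewrite /between ray_dist // => rsp'; split.
    by move=> pM; move: rsp'; rewrite pM; have := mdist_ge0 (r s) M; lra.
  apply: (KP (r s)) => //; rewrite /between => h.
  have := metric_triangle (r 0) M p; have := mdist_ge0 (r s) M; lra.
exists r' => //; exists s; first by rewrite r'0; lra.
rewrite r's; apply: (KP (r u)) => //; apply: ray_side => //; lra.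
Qed.

Lemma half_cover M K Z : Z <> inl M -> half M K Z \/ half M (fun p => ~ K p) Z.
Proof.
case: Z => [p pM|A _].
  have {}pM : p <> M by move=> e; apply: pM; rewrite e.
  by case: (EM (K p)) => h; [left|right].
have [r Ar] := end_nonempty A.
have lt : mdist (r 0) M < mdist (r 0) M + 1 by lra.
by case: (EM (K (r (mdist (r 0) M + 1)))) => h; [left|right]; exists r => //;
  exists (mdist (r 0) M + 1).
Qed.

Lemma half_disjoint M K Z : side_invariant M K ->
  half M K Z -> ~ half M (fun p => ~ K p) Z.
Proof.
move=> KP; case: Z => [p [_ Kp] [_]//|A [r Ar [u uM Kru]] [r' Ar' [v vM]]]; apply.
have [rr rr'] := (end_ray Ar, end_ray Ar').
have [B hB] := end_asymptotic Ar Ar'.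
(* At time [w] both rays are past [M], and [r w] is farther than [B] from [M]; since [r' w] is
   within [B] of [r w], the point [M] does not separate them. *)
pose w := u + v + `|B|.
have m0 := mdist_ge0 (r 0) M; have m0' := mdist_ge0 (r' 0) M.
have nB := ler_norm B; have nB0 := normr_ge0 B.
have w0 : 0 <= w by rewrite /w; lra.
apply: (KP (r' w)); first by apply: ray_side; rewrite // /w; lra.
apply: (KP (r w)); last by apply: (KP (r u)) => //; apply: ray_side; rewrite // /w; lra.
apply: ball_side; apply: le_lt_trans (hB w w0) _.
have := metric_triangle (r 0) M (r w); rewrite ray_dist // (metric_sym M) /w; lra.
Qed.

(** The halves of [K] and of its complement are disjoint open sets covering everything but [M], so
    each is clopen there and contains the components that it meets. *)
Lemma half_component M K Z Z' : side_invariant M K -> half M K Z ->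
  connected_component (~` [set (inl M : hat T)]) Z Z' -> half M K Z'.
Proof.
move=> KP hZ [C [CZ CM Cconn] CZ'].
suff /seteqP[_ /(_ _ CZ')[]] : C `&` half M K = C by [].
apply: Cconn; first by exists Z.
- by exists (half M K) => //; exact: open_half.
exists (~` half M (fun p => ~ K p)).
  exact/open_closedC/open_half/side_invariantN.
apply/seteqP; split=> W [CW hW]; split=> //; first exact: half_disjoint.
by have [] := half_cover K (CM _ CW).
Qed.

Lemma cvg_direction (p : nat -> T) Z M K : side_invariant M K ->
  (fun n => inl (p n) : obs T) @ \oo --> (Z : obs T) -> half M K Z ->
  \forall n \near \oo, K (p n).
Proof.
move=> KP pZ hZ.
have ZM : Z <> inl M by move=> e; move: hZ; rewrite e => -[].
have nZ : nbhs (Z : obs T) (connected_component (~` [set (inl M : hat T)]) Z).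
  rewrite nbhsE; exists (connected_component (~` [set (inl M : hat T)]) Z) => //.
  split; last exact: (@connected_component_refl (hat T) _ Z ZM).
  by apply: open_direction; exists (inl M), Z.
by have [m _ h] := pZ _ nZ; exists m => // n mn; have [] := half_component KP hZ (h n mn).
Qed.

(** If [Z] differed from [h x], some [M] would separate them. Pulled back to [M'], it leaves [p n]
    eventually on the side of [x], so [h (p n)] lies on the side of [h x], although convergence to
    [Z] puts it on the other side of [M]. *)
Lemma homothety_limit (c : R) (h : T -> T) (p : nat -> T) x Z :
  Rtree T -> 0 < c -> homothety c h ->
  (fun n => inl (p n) : obs T) @ \oo --> (inl x : obs T) ->
  (fun n => inl (h (p n)) : obs T) @ \oo --> (Z : obs T) -> Z = inl (h x).
Proof.
move=> [geo hyp] c0 [hd hs] px hpZ; apply: contrapT => Zhx.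
have [M Mhx hM] : exists2 M, M <> h x & half M (fun p => ~ ~ between (h x) M p) Z.
  case: Z Zhx {hpZ} => [z|A] Zhx.
    have hxz : h x <> z by move=> e; apply: Zhx; rewrite e.
    have d0 : 0 < mdist (h x) z by rewrite mdist_gt0; exact/eqP.
    have [g [g0 gd gP]] := geo (h x) z.
    (* When [Z] is a point, [M] is the midpoint of the segment from [h x] to it. *)
    pose t := mdist (h x) z / 2.
    have d1 : mdist (h x) (g t) = t.
      by rewrite -g0 gP ?g0; [rewrite sub0r normrN ger0_norm|..]; rewrite /t ?lexx; lra.
    have d2 : mdist (g t) z = t.
      by rewrite -{1}gd gP; [rewrite ler0_norm|..]; rewrite /t ?lexx; lra.
    exists (g t); first by move=> e; move: d1; rewrite e mdistxx /t; lra.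
    split; first by move=> e; move: d2; rewrite -e mdistxx /t; lra.
    by apply; rewrite /between d1 d2 /t; lra.
  have [r Ar] := end_nonempty A; have rr := end_ray Ar.
  (* When [Z] is an end, [M] is taken on a ray at a distance from [r 0] exceeding that of [h x], so
     [h x] cannot lie behind [M] as seen from [r 0]. *)
  pose t := mdist (r 0) (h x) + 1.
  have m0 := mdist_ge0 (r 0) (h x).
  have t0 : 0 <= t by rewrite /t; lra.
  have t1 : 0 <= t + 1 by rewrite /t; lra.
  exists (r t).
    by move=> e; have := ray_dist rr t0; rewrite e /t; lra.
  exists r => //; exists (t + 1); first by rewrite ray_dist //; lra.
  apply; have : between (r 0) (r t) (r (t + 1)).
    by rewrite /between !ray_dist // rr // opprD addNKr normrN normr1.
  case/(between_branch (h x) hyp); last exact: between_sym.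
  by rewrite /between ray_dist //; have := mdist_ge0 (r t) (h x); rewrite /t; lra.
have [M' M'M] := hs M.
have hx : half M' (fun p => ~ between x M' p) (inl x).
  have xM' : x <> M' by move=> e; apply: Mhx; rewrite -M'M e.
  split=> //; rewrite /between mdistxx (metric_sym M' x).
  have : 0 < mdist x M' by rewrite mdist_gt0; exact/eqP.
  lra.
have [n _ h1] := cvg_direction (side_invariant_between hyp) px hx.
have [m _ h2] := cvg_direction (side_invariantN (side_invariant_between hyp)) hpZ hM.
apply: (h2 (maxn n m)); rewrite /= ?leq_maxr // -M'M /between !hd -mulrDr.
by move/(mulfI (lt0r_neq0 c0)); apply: h1; rewrite /= leq_maxl.
Qed.

End MetricTreeSides.

(** * Twisted homotheties and the map Q *)

Section Homotheties.
Variables (R : realType) (N : nat).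
Implicit Types (T Tb : Ftree R N).

Lemma homothety_inj (X : metricType R) (c : R) (h : X -> X) :
  0 < c -> homothety c h -> injective h.
Proof.
move=> c0 [hd _] x y e; apply: mdist_positivity; apply: (mulfI (lt0r_neq0 c0)).
by rewrite -hd e mdistxx mulr0.
Qed.

(** A ratio at most 0 would make all distances in the image of [h] vanish. As [h] is onto, [Tb] and
    hence [T] would be a single point, fixed by the whole group. *)
Lemma homothety_ratio_gt0 T Tb (i : T -> Tb) (c : R) (h : Tb -> Tb) :
  ~ (exists x : T, forall u, tact u x = x) ->
  (forall x y, mdist (i x) (i y) = mdist x y) -> homothety c h -> 0 < c.
Proof.
move=> nofix iP [hd hs]; rewrite ltNge; apply/negP => c0; apply: nofix.
have [x _] := tree_nonempty T; exists x => u; apply: mdist_positivity.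
have [y yE] := hs (i (tact u x)); have [z zE] := hs (i x).
apply/eqP; rewrite -iP -yE -zE eq_le mdist_ge0 andbT hd.
by rewrite mulr_le0_ge0 ?mdist_ge0.
Qed.

Lemma homothety_inverse (X : metricType R) (c : R) (h : X -> X) :
  0 < c -> homothety c h ->
  exists g, [/\ cancel h g, cancel g h & homothety c^-1 g].
Proof.
move=> c0 hh; have [hd hs] := hh; have [g gK] := choice hs.
have hK : cancel h g by move=> x; apply: (homothety_inj c0 hh); rewrite gK.
exists g; split=> //; split=> [x y|y]; last by exists (h y).
by rewrite -{2}[x]gK -{2}[y]gK hd mulKf ?lt0r_neq0.
Qed.

(** [Q] is a limit along orbits: [h] carries the orbit of [x0] under [u n] to the orbit of [h x0]
    under [phi (u n)], and the limits of the two orbits are [Q X] and [Q Y]. *)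
Lemma Qmap_twisted Tb (Q : boundary N -> obs Tb) (phi : aut N) (c : R) (h : Tb -> Tb)
    (X Y : boundary N) x :
  is_Qmap Q -> 0 < c -> homothety c h -> twisted_equivariant phi h ->
  (forall u, cvg_bd u X -> cvg_bd (fun n => phi (u n)) Y) ->
  Q X = inl x -> Q Y = inl (h x).
Proof.
move=> [_ _ Qlim] c0 hh hphi XY QX.
have [u uX] := boundary_approx X; have [x0 _] := tree_nonempty Tb.
have := Qlim x0 _ _ uX; rewrite QX => lim1.
have := Qlim (h x0) _ _ (XY _ uX).
rewrite (_ : (fun n => _) = (fun n => inl (h (tact (u n) x0)) : obs Tb)); last first.
  by apply/funext => n; rewrite hphi.
exact: (homothety_limit (tree_Rtree Tb) c0 hh lim1).
Qed.

End Homotheties.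

Lemma pigeonhole_nat (A : choiceType) (D : set A) (P : nat -> A -> Prop) m :
  finite_set D -> (forall n, (m <= n)%N -> exists2 t, D t & P n t) ->
  exists2 t, D t & forall k, exists2 n, (k <= n)%N & P n t.
Proof.
move=> /finite_seqP[s ->] DP; apply: contrapT => no.
have /choice[K KP] t : exists k, t \in s -> forall n, (k <= n)%N -> ~ P n t.
  apply: contrapT => h; apply: no.
  have ts : t \in s by apply: contrapT => ts; apply: h; exists 0%N.
  exists t => // k; apply: contrapT => h'; apply: h; exists k => _ n kn Pn.
  by apply: h'; exists n.
pose n := maxn m (\max_(t <- s) K t).
have [t /= ts] := DP n (leq_maxl _ _); apply: KP => //.
by apply: leq_trans (leq_maxr _ _); apply: leq_bigmax_seq.
Qed.

Lemma cvg_cover_shift N (C : chart N) (x : nat -> vert (ucover C)) X :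
  cvg_cover x X -> cvg_cover (fun n => x n.+1) X.
Proof. by case=> xi xiX /cvg_word_shift ?; exists xi. Qed.

Lemma cvg_cover_shiftV N (C : chart N) (x : nat -> vert (ucover C)) X :
  cvg_cover (fun n => x n.+1) X -> cvg_cover x X.
Proof.
by case=> xi xiX xc; exists xi => //; exact: (@cvg_word_shiftV _ (fun n => val (x n))).
Qed.

Lemma conj_mul N (w : free_group N) :
  {morph (fun u => w * u * w^-1)%g : u v / (u * v)%g}.
Proof. by move=> u v; rewrite !mulgA mulgVK. Qed.

Lemma conj_conjV N (w : free_group N) :
  cancel (fun u => w * u * w^-1)%g (fun u => w^-1 * u * w)%g.
Proof. by move=> u; rewrite !mulgA mulVg mul1g mulgVK. Qed.

Lemma conjV_conj N (w : free_group N) :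
  cancel (fun u => w^-1 * u * w)%g (fun u => w * u * w^-1)%g.
Proof. by move=> u; rewrite !mulgA mulgV mul1g mulgK. Qed.

(** The automorphism by which the translations [dact w] and [tact w] are twisted; it makes deck
    transformations an instance of twisted maps. *)
Definition inner_aut N (w : free_group N) : aut N :=
  Aut (@conj_mul N w) (@conj_conjV N w) (@conjV_conj N w).

(** * The sets Omega *)

Section OmegaSets.
Variables (R : realType) (N : nat) (phi : aut N) (C : chart N) (f : graph_map C C).
Variables (Tb : Ftree R N) (Q : boundary N -> obs Tb) (e0 : edge (ucover C)).
Variable ft : graph_map (ucover C) (ucover C).
Hypothesis htt : is_train_track f.
Hypothesis hQ : is_Qmap Q.
Hypothesis hft : associated_lift f phi ft.

Let Om := @Omega R N Tb Q C (attracting_lamination phi f e0).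
Let o eps := if eps then e0 else grev e0.

Lemma attracting_laminationP X Y :
  attracting_lamination phi f e0 (X, Y) <-> X <> Y /\
  exists eps (u : nat -> free_group N),
    cvg_cover (fun n => dact (u n) (iter n ft (org (o eps)))) X /\
    cvg_cover (fun n => dact (u n) (iter n ft (tgt (o eps)))) Y.
Proof.
split=> [[XY [psi [gt [_ hgt [eps [u [uX uY]]]]]]]|[XY [eps [u [uX uY]]]]]; split=> //; last first.
  exists phi, ft; split=> //; last by exists eps, u.
  by exists 1%g => v; rewrite mul1g invg1 mulg1.
have [d [gtE _ _]] := associated_lifts_differ_by_deck hft hgt.
have [_ _ fu _] := hft.
(* The deck transformations relating the iterates obey $D_{n+1} = d\,\varphi(D_n)$. *)
have /choice[D DP] n : exists d', forall x, iter n gt x = dact d' (iter n ft x).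
  elim: n => [|n [d' IH]]; first by exists 1%g => x; rewrite dact1.
  by exists (d * phi d')%g => x; rewrite !iterS IH gtE fu -dactM.
exists eps, (fun n => (u n * D n)%g).
move: uX uY; rewrite /= -/(o eps).
rewrite (_ : (fun n => _) = fun n => dact (u n * D n)%g (iter n ft (org (o eps)))); last first.
  by apply/funext => n; rewrite DP dactM.
rewrite (_ : (fun n => dact (u n) (iter n gt (tgt (o eps)))) =
  fun n => dact (u n * D n)%g (iter n ft (tgt (o eps)))) //.
by apply/funext => n; rewrite DP dactM.
Qed.

Lemma OmegaP e x : Om e x <-> exists X Y eps (u : nat -> free_group N),
  [/\ X <> Y, cvg_cover (fun n => dact (u n) (iter n ft (org (o eps)))) X /\
      cvg_cover (fun n => dact (u n) (iter n ft (tgt (o eps)))) Y,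
      Q X = inl x /\ Q Y = inl x & end_side e X false /\ end_side e Y true].
Proof.
split=> [[[X Y] [[cyl /attracting_laminationP[XY [eps [u lim]]]] [_ /= QXY]] /= QX]|].
  by exists X, Y, eps, u; split; rewrite -?QXY //; exact/cyl_edgeP.
move=> [X [Y [eps [u [XY lim [QX QY] /(cyl_edgeP _ XY) cyl]]]]].
exists (X, Y) => //=; split; last by split; rewrite /= ?QX ?QY.
by split=> //; apply/attracting_laminationP; split=> //; exists eps, u.
Qed.

(** The common argument for translation by a deck transformation and for the lift itself. [Fpath]
    transports crossings of [e'] to crossings of [e], and [Flim] says that the image line is again
    approximated by translates of iterates of the same edge. *)
Lemma Omega_push (theta : aut N) (F : vert (ucover C) -> vert (ucover C))
    (c : R) (h : Tb -> Tb) (e e' : edge (ucover C)) :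
  (forall u x, F (dact u x) = dact (theta u) (F x)) ->
  0 < c -> homothety c h -> twisted_equivariant theta h ->
  (forall n u a, e' \in iterated_edge ft n u a -> exists p,
    [/\ epath (F (dact u (iter n ft (org a)))) p,
      pend (F (dact u (iter n ft (org a)))) p = F (dact u (iter n ft (tgt a))),
      greduced p & e \in p]) ->
  (forall u : nat -> free_group N, exists v : nat -> free_group N, forall y X,
    cvg_cover (fun n => F (dact (u n) (iter n ft y))) X ->
    cvg_cover (fun n => dact (v n) (iter n ft y)) X) ->
  forall x, Om e' x -> Om e (h x).
Proof.
move=> FP c0 hh htheta Fpath Flim x /OmegaP[X [Y [eps [u [XY [uX uY] [QX QY] [eX eY]]]]]].
have [X' [X'bd X'P]] := cvg_twisted X FP.
have [Y' [Y'bd Y'P]] := cvg_twisted Y FP.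
have FX := X'P _ uX; have FY := Y'P _ uY.
have [v vP] := Flim u.
have cross m : exists2 n, (m <= n)%N &
    ~~ side e (F (dact (u n) (iter n ft (org (o eps))))) /\
    side e (F (dact (u n) (iter n ft (tgt (o eps))))).
  have [m1 _ h1] := eX _ uX; have [m2 _ h2] := eY _ uY.
  pose n := maxn m (maxn m1 m2).
  have m1n : (m1 <= n)%N by rewrite /n !leq_max leqnn orbT.
  have m2n : (m2 <= n)%N by rewrite /n !leq_max leqnn !orbT.
  exists n; first exact: leq_maxl.
  have [pp pe rp] := iterated_edge_path hft htt n (u n) (o eps).
  have [|p [pp' <- rp' ep]] := Fpath n (u n) (o eps).
    by apply: (path_cross pp); rewrite ?pe ?h1 ?h2.
  exact: reduced_path_cross.
apply/OmegaP; exists X', Y', eps, v; split.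
(* Distinct ends stay distinct: if the images agreed, [cvg_twisted_inv] would give both original
   sequences the same limit. *)
- move=> X'Y'; apply: XY; rewrite -X'Y' in FY.
  have [Z [_ ZP]] := cvg_twisted_inv X' FP.
  by rewrite (cvg_cover_unique uX (ZP _ FX)) (cvg_cover_unique uY (ZP _ FY)).
- by split; exact: vP.
- by split; [exact: (Qmap_twisted hQ c0 hh htheta X'bd QX)|
    exact: (Qmap_twisted hQ c0 hh htheta Y'bd QY)].
- split; [apply: (end_side_frequently FX)|apply: (end_side_frequently FY)] => m;
    by have [n mn [nX nY]] := cross m; exists n => //; exact/negbTE.
Qed.

Lemma Omega_deck (w : free_group N) e x : Om e x -> Om (dact_edge w e) (tact w x).
Proof.
apply: (@Omega_push (inner_aut w) (dact w) 1) => //.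
- by move=> u y; rewrite /= -!dactM mulgVK.
- split=> [y z|y]; first by rewrite tact_isom mul1r.
  by exists (tact w^-1%g y); rewrite -tactM mulgV tact1.
- by move=> u y; rewrite /= -!tactM mulgVK.
- move=> n u a ea; have [pp pe rp] := iterated_edge_path hft htt n u a.
  exists (map (dact_edge w) (iterated_edge ft n u a)); split.
  + by rewrite epath_dact.
  + by rewrite pend_dact pe.
  + have pp' := pp; rewrite -(epath_dact w) in pp'.
    by rewrite (greduced_proj pp') map_ceproj_dact -(greduced_proj pp).
  + exact: (map_f (dact_edge w) ea).
- move=> u; exists (fun n => w * u n)%g => y X.
  by under eq_fun do rewrite -dactM.
Qed.

Lemma in_pmap e (p : seq (edge (ucover C))) :
  e \in pmap_edge ft p <-> exists2 t, decomposition ft e t & t.1.1 \in p.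
Proof.
split=> [/flatten_mapP[e' e'p ee']|[[[e' q] s] /in_decomposition h /= e'p]].
  have [q [s h]] : exists q s, emap ft e' = q ++ e :: s.
    by case/splitPr: ee' => q s; exists q, s.
  by exists (e', q, s) => //; exact/in_decomposition.
by apply/flatten_mapP; exists e' => //; rewrite h mem_cat inE eqxx orbT.
Qed.

Variables (c : R) (H : Tb -> Tb).
Hypotheses (c0 : 0 < c) (hH : homothety c H) (tH : twisted_equivariant phi H).

Lemma Omega_homothety e t x : decomposition ft e t -> Om t.1.1 x -> Om e (H x).
Proof.
move=> et; have [_ _ fu _] := hft.
apply: (@Omega_push phi ft c) => //.
- move=> n u a ta.
  have [pp pe rp] := iterated_edge_path hft htt n.+1 (phi u) a.
  exists (iterated_edge ft n.+1 (phi u) a); split=> //.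
  + by rewrite fu.
  + by rewrite !fu.
  + by rewrite -(pmap_iterated_edge hft); apply/in_pmap; exists t.
(* The lift turns the [n]-th iterate into the next one, so the translations move up by one index;
   the value at 0 does not affect the limit. *)
- move=> u; exists (fun n => if n is m.+1 then phi (u m) else 1%g) => y X FX.
  apply: cvg_cover_shiftV; move: FX.
  by under eq_fun do rewrite fu.
Qed.

Lemma Omega_decomposition e x : Om e x ->
  exists2 t, decomposition ft e t & (H @` Om t.1.1) x.
Proof.
move=> /OmegaP[X [Y [eps [u [XY [uX uY] [QX QY] [eX eY]]]]]].
have [_ _ fu _] := hft.
have [g [gK Kg gh]] := homothety_inverse c0 hH.
have cV0 : 0 < c^-1 by rewrite invr_gt0.
have tg : twisted_equivariant (aut_inv phi) g.
  by move=> v y; rewrite -{1}[y]Kg -{1}[v](aut_bwdK phi) -tH gK.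
(* Chosen so that [ft] sends the translate by [w n] of the [n]-th iterate to the translate by
   [u n.+1] of the next iterate. *)
pose w n := aut_inv phi (u n.+1).
have ftE y : (fun n => ft (dact (w n) (iter n ft y))) =
    (fun n => dact (u n.+1) (iter n.+1 ft y)).
  by apply/funext => n; rewrite fu /w /= aut_bwdK.
have FX : cvg_cover (fun n => ft (dact (w n) (iter n ft (org (o eps))))) X.
  by rewrite ftE; exact: (cvg_cover_shift uX).
have FY : cvg_cover (fun n => ft (dact (w n) (iter n ft (tgt (o eps))))) Y.
  by rewrite ftE; exact: (cvg_cover_shift uY).
have [X1 [X1bd /(_ _ FX) wX]] := cvg_twisted_inv X fu.
have [Y1 [Y1bd /(_ _ FY) wY]] := cvg_twisted_inv Y fu.
have [m1 _ h1] := eX _ uX; have [m2 _ h2] := eY _ uY.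
(* For large [n] the image path crosses [e], but through an edge that varies with [n]; pigeonhole
   over the finite decomposition fixes one triple that recurs. *)
have [t et tP] : exists2 t, decomposition ft e t & forall k, exists2 n, (k <= n)%N &
    t.1.1 \in iterated_edge ft n (w n) (o eps).
  apply: (@pigeonhole_nat _ _ _ (maxn m1 m2) (finite_decomposition hft e)) => n.
  rewrite geq_max => /andP[m1n m2n]; apply/in_pmap.
  rewrite (pmap_iterated_edge hft) /w /= aut_bwdK.
  have [pp pe rp] := iterated_edge_path hft htt n.+1 (u n.+1) (o eps).
  by apply: (path_cross pp); rewrite ?pe ?(h1 n.+1) ?(h2 n.+1) //= leqW.
exists t => //; exists (g x); last exact: Kg.
apply/OmegaP; exists X1, Y1, eps, w; split.
- move=> X1Y1; apply: XY; rewrite -X1Y1 in wY.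
  have [Z [_ ZP]] := cvg_twisted X1 fu.
  by rewrite (cvg_cover_unique FX (ZP _ wX)) (cvg_cover_unique FY (ZP _ wY)).
- by [].
- by split; [exact: (Qmap_twisted hQ cV0 gh tg X1bd QX)|
    exact: (Qmap_twisted hQ cV0 gh tg Y1bd QY)].
- split; [apply: (end_side_frequently wX)|apply: (end_side_frequently wY)] => m;
    have [n mn tn] := tP m; exists n => //;
    have [pp pe rp] := iterated_edge_path hft htt n (w n) (o eps);
    have [s1 s2] := reduced_path_cross pp rp tn; first exact/negbTE.
  by rewrite -pe.
Qed.

(** For a point of the form [Q X], either homothety must give the value of [Q] at the image of [X]
    under [phi], which involves no homothety. *)
Lemma twisted_homotheties_agree (c' : R) (H' : Tb -> Tb) e x :
  0 < c' -> homothety c' H' -> twisted_equivariant phi H' -> Om e x -> H' x = H x.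
Proof.
move=> c'0 hH' tH' /OmegaP[X [_ [_ [_ [_ _ [QX _] _]]]]].
have [Y YP] := aut_extension phi X.
have := Qmap_twisted hQ c0 hH tH YP QX.
by rewrite (Qmap_twisted hQ c'0 hH' tH' YP QX) => -[].
Qed.

End OmegaSets.

Theorem proposition2p5 (R : realType) (N : nat) (hN : (2 <= N)%N)
  (phi : aut N) (hphi : irreducible_powers phi)
  (C : chart N) (f : graph_map C C) (hf : irreducible_train_track phi f)
  (T Tb : Ftree R N) (i : T -> Tb)
  (hT : repelling_tree T phi) (hTb : is_completion i)
  (Q : boundary N -> obs Tb) (hQ : is_Qmap Q)
  (e0 : edge (ucover C))
  (ft : graph_map (ucover C) (ucover C)) (hft : associated_lift f phi ft)
  (H : Tb -> Tb) (hH : associated_homothety phi H) :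
  let Om := Omega Q (attracting_lamination phi f e0) in
  (forall e : edge (ucover C),
     finite_set (decomposition ft e) /\
     Om e = \bigcup_(t in decomposition ft e) (H @` Om t.1.1)) /\
  (forall (phi' : aut N) (ft' : graph_map (ucover C) (ucover C)) (H' : Tb -> Tb),
     outer phi phi' -> associated_lift f phi' ft' -> associated_homothety phi' H' ->
     forall e : edge (ucover C),
     exists2 sigma, set_bij (decomposition ft e) (decomposition ft' e) sigma &
       forall t, decomposition ft e t -> H' @` Om (sigma t).1.1 = H @` Om t.1.1).
Proof.
have [_ htt _] := hf; have [[_ _ nofix] _ _] := hT; have [iP _ _ _] := hTb.
have [lam _ [hHl tH]] := hH; have c0 := homothety_ratio_gt0 nofix iP hHl.
move=> Om; split=> [e|phi' ft' H' _ hft' [lam' _ [hHl' tH']] e].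
  split; first exact: finite_decomposition hft e.
  apply/seteqP; split=> [x|x [t et [y ty <-]]].
    exact: (Omega_decomposition htt hQ hft c0 hHl tH).
  exact: (Omega_homothety htt hQ hft c0 hHl tH et ty).
have c'0 := homothety_ratio_gt0 nofix iP hHl'.
have [d [_ ft'E phi'E]] := associated_lifts_differ_by_deck hft hft'.
have [_ _ _ fu] := hft.
(* Since [ft'] is [d] after [ft], it sends the translate of [a] by [w] to the translate of the image
   of [a] by [d * phi w]; [w] is chosen to make this factor trivial. The bijection then translates
   the edge of each triple and keeps [p] and [s]. *)
pose w := aut_inv phi (d^-1)%g.
have phiw : phi w = (d^-1)%g by rewrite /w /= aut_bwdK.
have phiwV : phi (w^-1)%g = d.
  by apply: (mulIg (d^-1)%g); rewrite mulgV -phiw -aut_mul mulVg aut_one.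
have ft'w a : emap ft' (dact_edge w a) = emap ft a.
  rewrite ft'E fu phiw -map_comp map_id_in // => b _ /=.
  by rewrite -dact_edgeM mulgV dact_edge1.
exists (fun t => (dact_edge w t.1.1, t.1.2, t.2)).
  split.
  - by move=> [[a p] s] /in_decomposition h; apply/in_decomposition; rewrite ft'w.
  - move=> [[a p] s] [[b q] r] _ _ /= E; have /= h := congr1 (fun t => t.1.1) E.
    have /= -> := congr1 (fun t => t.1.2) E; have /= -> := congr1 snd E.
    congr (_, _, _).
    by rewrite -[a]dact_edge1 -[b]dact_edge1 -(mulVg w) !dact_edgeM h.
  move=> [[a p] s] /in_decomposition h; exists (dact_edge w^-1%g a, p, s) => /=.
    by apply/in_decomposition; rewrite -ft'w -dact_edgeM mulgV dact_edge1.
  by rewrite -dact_edgeM mulgV dact_edge1.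
(* As [phi'] maps [w] to $d^{-1}$, this is $d^{-1}H'$, written so that it is visibly twisted by
   [phi] itself and can be compared with [H]. *)
pose H2 x := H' (tact w x).
have hH2 : homothety lam'^-1 H2.
  have [hd hs] := hHl'; split=> [x y|y]; first by rewrite hd tact_isom.
  have [x <-] := hs y; exists (tact w^-1%g x).
  by rewrite /H2 -tactM mulgV tact1.
have tH2 : twisted_equivariant phi H2.
  move=> u x; rewrite /H2 -tactM -{1}(mulgVK w (w * u)%g) tactM tH'; congr tact.
  by rewrite phi'E !aut_mul phiw phiwV mulgA mulgK mulVKg.
have agree a x : Om a x -> H2 x = H x.
  exact: (twisted_homotheties_agree hQ hft c0 hHl tH c'0 hH2 tH2).
move=> t _ /=; apply/seteqP; split=> [_ [x xt <-]|_ [x xt <-]]; last first.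
  exists (tact w x); first exact: (Omega_deck htt hQ hft w xt).
  exact: agree xt.
(* A point of the translated set is brought back by the inverse of [w], where the two homotheties
   are known to agree. *)
have := Omega_deck htt hQ hft w^-1%g xt; rewrite -dact_edgeM mulVg dact_edge1 => xt'.
exists (tact w^-1%g x) => //.
by rewrite -(agree _ _ xt') /H2 -tactM mulgV tact1.
Qed.
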